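(* Let $R$ be a commutative Noetherian ring, $I,J$ ideals of $R$, $t\ge0$ an integer, $M$ a finitely generated $R$-module, and $\mathfrak a\in\tilde W(I,J)$. Suppose $H^i_{I,J}(M)=0$ for all $i<t$. If $\mathfrak a\subseteq\sqrt{(0:H^t_{I,J}(M))}$, then $\mathfrak a\subseteq\sqrt{(0:H^t_{\mathfrak a}(M))}$, and so $H^t_{\mathfrak a}(M)$ is finitely generated.
   Context: For ideals $I,J$ of $R$, $\tilde W(I,J)$ denotes the set of ideals $\mathfrak a$ of $R$ such that $I^n\subseteq\mathfrak a+J$ for some integer $n\ge1$. For an $R$-module $X$, $\Gamma_{I,J}(X)=\{x\in X: I^nx\subseteq Jx\text{ for some } n\ge1\}$; this defines a left exact functor $\Gamma_{I,J}$ on $R$-modules, and $H^i_{I,J}$ denotes its $i$-th right derived functor. $H^i_{\mathfrak a}=H^i_{\mathfrak a,0}$ is ordinary local cohomology with respect to $\mathfrak a$. $(0:X)$ denotes the annihilator in $R$ of an $R$-module $X$. *)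

(* Defs.v *)
From HB Require Import structures.
From mathcomp Require Import all_boot all_order all_algebra.
From mathcomp Require Import generic_quotient ring_quotient.
From mathcomp Require Import boolp classical_sets functions.

Set Implicit Arguments.
Unset Strict Implicit.
Unset Printing Implicit Defensive.

Import Order.TTheory GRing.Theory Num.Theory.

Local Open Scope classical_set_scope.
Local Open Scope ring_scope.
Local Open Scope quotient_scope.

(* MathComp's idealr only covers proper ideals; here an ideal is an arbitrary
   R-submodule of R, the unit ideal included. *)
Notation ideal R := (submodClosed R^o).

Section Submodules.
Variables (R : pzRingType) (V : lmodType R).

Definition generated (S : set V) : {pred V} :=
  fun v => `[< forall N : submodClosed V, (forall w, S w -> w \in N) -> v \in N >].

Fact generated_closed S : subsemimod_closed (generated S).
Proof.
split; first split.
- by apply/asboolP => N _; exact: rpred0.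
- move=> u v /asboolP uS /asboolP vS; apply/asboolP => N SN.
  by apply: rpredD; [exact: uS|exact: vS].
- move=> a v /asboolP vS; apply/asboolP => N SN.
  by apply: rpredZ; exact: vS.
Qed.
HB.instance Definition _ S := GRing.isSubmodClosed.Build R V (generated S) (generated_closed S).

Definition fin_gen := exists s : seq V, forall v, v \in generated [set` s].

End Submodules.

Arguments fin_gen {R} V.

Section Submodule.
Variables (R : pzRingType) (V : lmodType R) (N : submodClosed V).

Definition submodule := {x : V | x \in N}.
HB.instance Definition _ := SubChoice.on submodule.
HB.instance Definition _ := [SubChoice_isSubLmodule of submodule by <:].

End Submodule.

Section QuotientModule.
Variables (R : pzRingType) (V : lmodType R) (N : submodClosed V).

(* Quotient.quot expects a zmodClosed predicate, which the structure
   submodClosed alone does not provide. *)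
Definition submod_pred : {pred V} := N.
HB.instance Definition _ :=
  GRing.isSubmodClosed.Build R V submod_pred (GRing.subsemimodClosedP N).

Definition quot_module := Quotient.quot submod_pred.
HB.instance Definition _ := GRing.Zmodule.on quot_module.

Definition to_quotient (v : V) : quot_module := \pi_(Quotient.quot submod_pred) v.

Lemma to_quotient_eq u v : (to_quotient u = to_quotient v) <-> (u - v \in N).
Proof. by rewrite -[u - v \in N]/(u - v \in submod_pred) Quotient.idealrBE; split=> [/eqP //|/eqP]. Qed.

Lemma to_quotientP (q : quot_module) : exists v, to_quotient v = q.
Proof. by exists (repr q); exact: reprK. Qed.

Lemma to_quotientB u v : to_quotient (u - v) = to_quotient u - to_quotient v.
Proof. by rewrite /to_quotient raddfB. Qed.

Lemma to_quotientD u v : to_quotient (u + v) = to_quotient u + to_quotient v.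
Proof. by rewrite /to_quotient raddfD. Qed.

Definition quot_module_scale a (q : quot_module) := to_quotient (a *: repr (q : Quotient.quot submod_pred)).

Lemma to_quotientZ a v : quot_module_scale a (to_quotient v) = to_quotient (a *: v).
Proof.
apply/to_quotient_eq; rewrite -scalerBr; apply: rpredZ.
by apply/to_quotient_eq; rewrite {1}/to_quotient reprK.
Qed.

Fact quot_module_scaleA a b q :
  quot_module_scale a (quot_module_scale b q) = quot_module_scale (a * b) q.
Proof. by have [v <-] := to_quotientP q; rewrite !to_quotientZ scalerA. Qed.
Fact quot_module_scale1 : left_id 1 quot_module_scale.
Proof. by move=> q; have [v <-] := to_quotientP q; rewrite !to_quotientZ scale1r. Qed.
Fact quot_module_scaleDr : right_distributive quot_module_scale +%R.
Proof.
move=> a p q; have [u <-] := to_quotientP p; have [v <-] := to_quotientP q.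
by rewrite -to_quotientD !to_quotientZ scalerDr to_quotientD.
Qed.
Fact quot_module_scaleDl q : {morph quot_module_scale^~ q : a b / a + b}.
Proof.
by move=> a b; have [v <-] := to_quotientP q; rewrite !to_quotientZ scalerDl to_quotientD.
Qed.
HB.instance Definition _ := GRing.Zmodule_isLmodule.Build R quot_module
  quot_module_scaleA quot_module_scale1 quot_module_scaleDr quot_module_scaleDl.

Fact to_quotient_linear : linear to_quotient.
Proof. by move=> a u v; rewrite to_quotientD -to_quotientZ. Qed.
HB.instance Definition _ := GRing.isLinear.Build R V quot_module _ to_quotient to_quotient_linear.

End QuotientModule.

Section Ideals.
Variable R : comPzRingType.
Implicit Types I J : ideal R.

Definition noetherian := forall I : ideal R, exists s : seq R^o, I =i generated [set` s].

Definition zero_ideal : {pred R^o} := fun x => x == 0.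
Fact zero_ideal_closed : subsemimod_closed zero_ideal.
Proof.
split; first split; rewrite ?unfold_in //.
- by move=> x y /eqP -> /eqP ->; rewrite unfold_in addr0.
- by move=> a x /eqP ->; rewrite unfold_in scaler0.
Qed.
HB.instance Definition _ := GRing.isSubmodClosed.Build R R^o zero_ideal zero_ideal_closed.

Definition ideal_add I J : {pred R^o} :=
  fun x => `[< exists a b, [/\ a \in I, b \in J & x = a + b] >].
Fact ideal_add_closed I J : subsemimod_closed (ideal_add I J).
Proof.
split; first split.
- by apply/asboolP; exists 0, 0; rewrite !rpred0 addr0.
- move=> x y /asboolP[a [b [aI bJ ->]]] /asboolP[c [d [cI dJ ->]]].
  by apply/asboolP; exists (a + c), (b + d); rewrite !rpredD // addrACA.
- move=> r x /asboolP[a [b [aI bJ ->]]]; apply/asboolP.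
  by exists (r *: a), (r *: b); rewrite !rpredZ // scalerDr.
Qed.
HB.instance Definition _ I J :=
  GRing.isSubmodClosed.Build R R^o (ideal_add I J) (ideal_add_closed I J).

Definition ideal_exp I n : {pred R^o} :=
  generated [set x : R^o | exists2 f : 'I_n -> R^o,
          forall i, f i \in I & x = \prod_(i < n) (f i : R)].
HB.instance Definition _ I n := GRing.SubmodClosed.on (ideal_exp I n).

Definition radical I : {pred R^o} :=
  fun x => `[< exists2 n, (0 < n)%N & (x : R) ^+ n \in I >].

Definition annihilator (X : lmodType R) : {pred R^o} :=
  fun a => `[< forall x : X, a *: x = 0 >].
Fact annihilator_closed X : subsemimod_closed (annihilator X).
Proof.
split; first split.
- by apply/asboolP => x; rewrite scale0r.
- move=> a b /asboolP aX /asboolP bX; apply/asboolP => x.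
  by rewrite scalerDl aX bX addr0.
- move=> r a /asboolP aX; apply/asboolP => x.
  by rewrite -[r *: a]/(r * a) -scalerA aX scaler0.
Qed.
HB.instance Definition _ X :=
  GRing.isSubmodClosed.Build R R^o (annihilator X) (annihilator_closed X).

Definition W_tilde I J (a : ideal R) :=
  exists2 n, (0 < n)%N & {subset ideal_exp I n <= ideal_add a J}.

End Ideals.

Arguments noetherian R : clear implicits.
Arguments zero_ideal {R}.

(* Additive endofunctors of the category of R-modules. *)
Record mod_functor (R : pzRingType) := ModFunctor {
  fobj :> lmodType R -> lmodType R;
  fmap : forall A B : lmodType R, {linear A -> B} -> {linear fobj A -> fobj B};
  fmap_id : forall (A : lmodType R) x, @fmap A A idfun x = x;
  fmap_comp : forall (A B C : lmodType R) (g : {linear B -> C}) (f : {linear A -> B}) x,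
    fmap (g \o f) x = fmap g (fmap f x);
  fmapD : forall (A B : lmodType R) (f g : {linear A -> B}) x,
    fmap (f \+ g) x = fmap f x + fmap g x
}.
Arguments fmap {R} F {A B} f : rename.
Arguments fmap_id {R} F {A} x : rename.
Arguments fmap_comp {R} F {A B C} g f x : rename.
Arguments fmapD {R} F {A B} f g x : rename.

Section Torsion.
Variables (R : comPzRingType) (I J : ideal R).

Section Object.
Variable X : lmodType R.

(* The membership condition of Gamma_{I,J}(X): I^n x is contained in J x. *)
Definition torsion : {pred X} := fun x =>
  `[< exists2 n, (0 < n)%N & forall a, a \in ideal_exp I n ->
        exists2 b, b \in J & a *: x = b *: x >].

Lemma torsionD_aux (x y : X) n m :
    (forall a, a \in ideal_exp I n -> exists2 b, b \in J & a *: x = b *: x) ->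
    (forall a, a \in ideal_exp I m -> exists2 b, b \in J & a *: y = b *: y) ->
  forall a, a \in ideal_exp I (n + m) ->
    exists b, [/\ b \in J, a *: x = b *: x & a *: y = b *: y].
Proof.
move=> nx my.
pose C : {pred R^o} := fun a =>
  `[< exists b, [/\ b \in J, a *: x = b *: x & a *: y = b *: y] >].
have Cclosed : subsemimod_closed C.
  split; first split.
  - by apply/asboolP; exists 0; rewrite rpred0 !scale0r.
  - move=> a a' /asboolP[b [bJ ax ay]] /asboolP[b' [b'J a'x a'y]].
    by apply/asboolP; exists (b + b'); rewrite rpredD // !scalerDl ax ay a'x a'y.
  - move=> r a /asboolP[b [bJ ax ay]]; apply/asboolP; exists (r *: b).
    by rewrite rpredZ // -![r *: _]/(r * _) -!scalerA ax ay.
pose CM := GRing.isSubmodClosed.Build R R^o C Cclosed.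
pose CC : submodClosed R^o := HB.pack C CM.
move=> a /asboolP/(_ CC) aC; apply/asboolP; apply: aC => _ [f fI ->].
rewrite big_split_ord /=; set u := \prod_(i < n) _; set v := \prod_(i < m) _.
have [b bJ ub] : exists2 b, b \in J & u *: x = b *: x.
  apply: nx; apply/asboolP => N; apply.
  by exists (fun i => f (lshift m i)) => // i; exact: fI.
have [c cJ vc] : exists2 c, c \in J & v *: y = c *: y.
  apply: my; apply/asboolP => N; apply.
  by exists (fun i => f (rshift n i)) => // i; exact: fI.
apply/asboolP; exists (v *: b + u *: c - b *: c); split.
- by rewrite -scaleNr !rpredD ?rpredZ.
- rewrite scalerBl scalerDl (_ : (u *: c) *: x = (b *: c) *: x).
    by rewrite addrK -![_ *: (_ : R^o)]/(_ * _) mulrC -!scalerA ub.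
  by rewrite -![_ *: (_ : R^o)]/(_ * _) ![_ * c]mulrC -!scalerA ub.
- rewrite scalerBl scalerDl (_ : (v *: b) *: y = (b *: c) *: y).
    by rewrite [_ *: y + _]addrC addrK -![_ *: (_ : R^o)]/(_ * _) -!scalerA vc.
  by rewrite -![_ *: (_ : R^o)]/(_ * _) [v * b]mulrC -!scalerA vc.
Qed.

Fact torsion_closed : subsemimod_closed torsion.
Proof.
split; first split.
- by apply/asboolP; exists 1 => // a _; exists 0; rewrite ?rpred0 // !scaler0.
- move=> x y /asboolP[n n0 nx] /asboolP[m m0 my]; apply/asboolP.
  exists (n + m)%N; first by rewrite addn_gt0 n0.
  move=> a /(torsionD_aux nx my)[b [bJ ax ay]].
  by exists b => //; rewrite !scalerDr ax ay.
- move=> r x /asboolP[n n0 nx]; apply/asboolP; exists n => // a /nx[b bJ ax].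
  by exists b => //; rewrite !scalerA ![_ * r]mulrC -!scalerA ax.
Qed.
HB.instance Definition _ := GRing.isSubmodClosed.Build R X torsion torsion_closed.

End Object.

Section Map.
Variables (X Y : lmodType R) (f : {linear X -> Y}).

Fact torsion_map_subproof (x : submodule (@torsion X)) : f (val x) \in @torsion Y.
Proof.
have /asboolP[n n0 nx] := valP x; apply/asboolP; exists n => // a /nx[b bJ ax].
by exists b => //; have := congr1 f ax; rewrite !linearZ.
Qed.
Definition torsion_map (x : submodule (@torsion X)) : submodule (@torsion Y) :=
  Sub (f (val x)) (torsion_map_subproof x).
Fact torsion_map_linear : linear torsion_map.
Proof. by move=> a x y; apply: val_inj; rewrite /= linearP. Qed.
HB.instance Definition _ :=
  GRing.isLinear.Build R (submodule (@torsion X)) (submodule (@torsion Y)) _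
    torsion_map torsion_map_linear.

End Map.

Definition Gamma : mod_functor R.
Proof.
refine (@ModFunctor R (fun X => submodule (@torsion X))
          (fun X Y f => torsion_map f) _ _ _) => *; exact: val_inj.
Defined.

End Torsion.

Definition injective_module (R : pzRingType) (E : lmodType R) :=
  forall (A B : lmodType R) (i : {linear A -> B}) (f : {linear A -> E}),
    injective i -> exists g : {linear B -> E}, forall a, g (i a) = f a.

Lemma linear_ext (R : pzRingType) (A B : lmodType R) (f g : {linear A -> B}) :
  f =1 g -> f = g.
Proof.
case: f => f [[p] [q]]; case: g => g [[p'] [q']] /= /funext fg.
move: p q p' q'; rewrite fg => p q p' q'.
by rewrite (Prop_irrelevance p p') (Prop_irrelevance q q').
Qed.

Section Complexes.
Variable R : pzRingType.

Record cochain_complex := CochainComplex {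
  cobj :> nat -> lmodType R;
  cdiff : forall n, {linear cobj n -> cobj n.+1};
  cdiffK : forall n x, cdiff n.+1 (cdiff n x) = 0
}.

Arguments cdiff c n : rename, clear implicits.

Section Cohomology.
Variables (C : cochain_complex) (n : nat).

Definition cocycle : {pred C n} := fun x => cdiff C n x == 0.
Fact cocycle_closed : subsemimod_closed cocycle.
Proof.
split; first split; rewrite ?unfold_in ?linear0 //.
- by move=> x y /eqP dx /eqP dy; rewrite unfold_in linearD /= dx dy addr0.
- by move=> a x /eqP dx; rewrite unfold_in linearZ /= dx scaler0.
Qed.
HB.instance Definition _ := GRing.isSubmodClosed.Build R (C n) cocycle cocycle_closed.

End Cohomology.

(* B^0 = 0 since C^{-1} = 0. *)
Definition is_coboundary (C : cochain_complex) n : C n -> Prop :=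
  match n with
  | 0 => fun x => x = 0
  | m.+1 => fun x => exists y : C m, x = cdiff C m y
  end.
Arguments is_coboundary : clear implicits.

Lemma is_coboundary0 C n : is_coboundary C n 0.
Proof. by case: n => [|n] //; exists 0; rewrite linear0. Qed.
Lemma is_coboundaryD C n x y :
  is_coboundary C n x -> is_coboundary C n y -> is_coboundary C n (x + y).
Proof.
case: n x y => [|n] x y /=; first by move=> -> ->; rewrite addr0.
by move=> [u ->] [v ->]; exists (u + v); rewrite linearD.
Qed.
Lemma is_coboundaryZ C n a x : is_coboundary C n x -> is_coboundary C n (a *: x).
Proof.
case: n x => [|n] x /=; first by move=> ->; rewrite scaler0.
by move=> [u ->]; exists (a *: u); rewrite linearZ.
Qed.

Definition coboundary (C : cochain_complex) n : {pred submodule (@cocycle C n)} :=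
  fun x => `[< is_coboundary C n (val x) >].
Fact coboundary_closed C n : subsemimod_closed (@coboundary C n).
Proof.
split; first split.
- by apply/asboolP; exact: is_coboundary0.
- by move=> x y /asboolP xB /asboolP yB; apply/asboolP; exact: is_coboundaryD.
- by move=> a x /asboolP xB; apply/asboolP; exact: is_coboundaryZ.
Qed.
HB.instance Definition _ C n := GRing.isSubmodClosed.Build R _
  (@coboundary C n) (@coboundary_closed C n).

Definition cohomology (C : cochain_complex) n : lmodType R :=
  quot_module (@coboundary C n).

Lemma fmap0 (F : mod_functor R) (A B : lmodType R) (f : {linear A -> B}) :
  (forall x, f x = 0) -> forall x, fmap F f x = 0.
Proof.
move=> f0 x; have := fmapD F f f x.
have -> : (f \+ f : {linear A -> B}) = f.
  by apply: linear_ext => y /=; rewrite !f0 addr0.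
by rewrite -[X in X = _]addr0 => /addrI <-.
Qed.

Section FmapComplex.
Variables (F : mod_functor R) (C : cochain_complex).
Fact fmap_cdiffK n x : fmap F (cdiff C n.+1) (fmap F (cdiff C n) x) = 0.
Proof. by rewrite -fmap_comp fmap0 // => y; exact: cdiffK. Qed.
Definition fmap_complex := @CochainComplex (fun n => F (C n))
  (fun n => fmap F (cdiff C n)) fmap_cdiffK.
End FmapComplex.

Record injective_resolution (M : lmodType R) := InjectiveResolution {
  ires_complex :> cochain_complex;
  ires_aug : {linear M -> ires_complex 0};
  ires_inj : forall n, injective_module (ires_complex n);
  ires_aug_inj : injective ires_aug;
  ires_exact0 : forall x, cdiff ires_complex 0 x = 0 <-> exists m, x = ires_aug m;
  ires_exactS : forall n (x : ires_complex n.+1),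
    cdiff ires_complex n.+1 x = 0 <-> exists y, x = cdiff ires_complex n y
}.

End Complexes.

(* Enough injectives: for an R-module M, the module of coinduced functions
   Hom_Z(R, prod_chi Q/Z), chi ranging over the characters M -> Q/Z, is
   injective and contains M. *)
Section Characters.

Definition Zrat : {pred rat} := fun q => q \is a Num.int.
Fact Zrat_closed : zmod_closed Zrat.
Proof. by split=> [|x y xZ yZ]; [exact: rpred0 | exact: rpredB]. Qed.
HB.instance Definition _ := GRing.isZmodClosed.Build rat Zrat Zrat_closed.

Definition QmodZ := Quotient.quot Zrat.
HB.instance Definition _ := GRing.Zmodule.on QmodZ.

Definition to_QmodZ (q : rat) : QmodZ := \pi_(Quotient.quot Zrat) q.

Lemma to_QmodZ_eq0 q : (to_QmodZ q = 0) <-> (q \is a Num.int).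
Proof.
have -> : (0 : QmodZ) = to_QmodZ 0 by rewrite /to_QmodZ raddf0.
rewrite -[q in q \is a _]subr0 -[_ \is a _]/(q - 0 \in Zrat).
by rewrite Quotient.idealrBE; split=> [/eqP //|/eqP].
Qed.
Lemma to_QmodZ_mulrz q k : to_QmodZ q *~ k = to_QmodZ (q *~ k).
Proof. by rewrite /to_QmodZ raddfMz. Qed.
Lemma QmodZ_divisible n (d : QmodZ) : (0 < n)%N -> exists e, e *+ n = d.
Proof.
move=> n0; exists (to_QmodZ (repr (d : Quotient.quot _) / n%:R)).
rewrite /to_QmodZ -raddfMn -[X in _ = X]reprK; congr (\pi _).
by rewrite -[LHS]mulr_natr divfK // pnatr_eq0 -lt0n.
Qed.

(* Partial additive maps B -> Q/Z, as graphs. *)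
Definition partial_additive (B : zmodType) (G : set (B * QmodZ)) :=
  [/\ G 0, forall p q, G p -> G q -> G (p - q) & forall d, G (0, d) -> d = 0].

Section Extension.
Variables (B : zmodType).
Implicit Type G : set (B * QmodZ).

Lemma partial_additiveN G p : partial_additive G -> G p -> G (- p).
Proof. by case=> G0 GB _ Gp; rewrite -sub0r; apply: GB. Qed.
Lemma partial_additiveD G p q : partial_additive G -> G p -> G q -> G (p + q).
Proof.
move=> GG Gp Gq; rewrite -[q]opprK; case: (GG) => _ GB _; apply: GB => //.
exact: partial_additiveN.
Qed.
Lemma partial_additiveMz G b d k :
  partial_additive G -> G (b, d) -> G (b *~ k, d *~ k).
Proof.
move=> GG Gbd; have Gn (n : nat) : G (b *+ n, d *+ n).
  elim: n => [|n IHn]; first by case: GG.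
  by rewrite !mulrS; exact: (partial_additiveD GG Gbd IHn).
case: k => n; first exact: Gn.
by rewrite NegzE !mulrNz; exact: (partial_additiveN GG (Gn n.+1)).
Qed.

Lemma partial_additive_value G b : partial_additive G ->
  exists d, forall k e, G (b *~ k, e) -> e = d *~ k.
Proof.
move=> GG; have [_ GB Gfun] := GG.
pose P n := (0 < n)%N && `[< exists e, G (b *+ n, e) >].
have [exP|nexP] := pselect (exists n, P n).
  have [n /andP[n0 /asboolP[e Gne]] nmin] := ex_minnP exP.
  have [d dn] := QmodZ_divisible e n0; exists d => k e' Gke'.
  have := GB _ _ Gke' (partial_additiveMz (k %/ n)%Z GG Gne).
  rewrite -[_ - _]/(b *~ k - b *+ n *~ (k %/ n)%Z, e' - e *~ (k %/ n)%Z).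
  have kE := divz_eq k n.
  have -> : b *~ k - b *+ n *~ (k %/ n)%Z = b *~ (k %% n)%Z.
    by rewrite {1}kE mulrzDr mulrC mulrzA pmulrn addrC addKr.
  have : (k %% n)%Z >= 0 by rewrite modz_ge0 // eqz_nat -lt0n.
  have : (k %% n)%Z < n by rewrite ltz_pmod.
  case: (k %% n)%Z kE => // r kE rn _ Gr.
  have r0 : r = 0%N.
    apply/eqP; rewrite -leqn0 leqNgt; apply/negP => r0.
    suff : (n <= r)%N by rewrite leqNgt -ltz_nat rn.
    by apply: nmin; rewrite /P r0; apply/asboolP; exists (e' - e *~ (k %/ n)%Z).
  move: Gr; rewrite r0 => /Gfun/eqP; rewrite subr_eq0 => /eqP ->.
  by rewrite {2}kE r0 addr0 -dn mulrC mulrzA pmulrn.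
exists 0 => k e Gke; rewrite mul0rz.
have [k0|k0|k0] := ltrgt0P k.
- case: nexP; exists `|k|%N; rewrite /P absz_gt0 gt_eqF //=.
  by apply/asboolP; exists e; rewrite pmulrn gtz0_abs.
- case: nexP; exists `|k|%N; rewrite /P absz_gt0 lt_eqF //=.
  apply/asboolP; exists (- e); rewrite pmulrn ltz0_abs // mulrNz.
  exact: (partial_additiveN GG Gke).
- by move: Gke; rewrite k0 => /Gfun.
Qed.

Lemma partial_additive_step G b : partial_additive G ->
  exists2 G', partial_additive G' & G `<=` G' /\ exists d, G' (b, d).
Proof.
move=> GG; have [d db] := partial_additive_value b GG.
have [G0 GB Gfun] := GG.
exists [set p | exists c v k, G (c, v) /\ p = (c + b *~ k, v + d *~ k)].
  split.
  - by exists 0, 0, 0; rewrite !mulr0z !addr0.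
  - move=> _ _ [c [v [k [Gcv ->]]]] [c' [v' [k' [Gcv' ->]]]].
    exists (c - c'), (v - v'), (k - k'); split; first exact: (GB _ _ Gcv Gcv').
    by rewrite !mulrzBr; congr (_, _); rewrite /= opprD addrACA.
  - move=> _ [c [v [k [Gcv [/esym/eqP + ->]]]]]; rewrite addr_eq0 => /eqP cE.
    move: Gcv; rewrite cE -mulrNz => /db ->.
    by rewrite mulrNz addNr.
split=> [[c v] Gcv|]; first by exists c, v, 0; rewrite !mulr0z !addr0.
by exists d, 0, 0, 1; rewrite !add0r !mulr1z.
Qed.

Lemma partial_additive_extend G : partial_additive G ->
  exists h : {additive B -> QmodZ}, forall b d, G (b, d) -> h b = d.
Proof.
move=> GG.
have [F FP Ftot|A [PA Amax]] :=
    @Zorn_bigcup _ (fun A => partial_additive (A `|` G)).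
  have [G0 GB Gfun] := GG; split; first by right.
  - move=> p q [[X FX Xp]|Gp] [[Y FY Yq]|Gq]; last by right; exact: GB.
    + have [Z [FZ Zp Zq]] : exists Z, [/\ F Z, Z p & Z q].
        have [XY|YX] := Ftot _ _ FX FY; first by exists Y; split=> //; exact: XY.
        by exists X; split=> //; exact: YX.
      have [_ /(_ p q) ZB _] := FP _ FZ.
      by case: ZB; [left|left|left; exists Z|right].
    + have [_ /(_ p q) ZB _] := FP _ FX.
      by case: ZB; [left|right|left; exists X|right].
    + have [_ /(_ p q) ZB _] := FP _ FY.
      by case: ZB; [right|left|left; exists Y|right].
  - move=> d [[X FX Xd]|]; last exact: Gfun.
    by have [_ _] := FP _ FX; apply; left.
have total b : exists d, (A `|` G) (b, d).
  apply: contrapT => nb; have [G' GG' [AG' [d G'b]]] := partial_additive_step b PA.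
  apply: (Amax G'); last first.
    by rewrite setUidl // => x Gx; apply: AG'; right.
  split; first by move=> x Ax; apply: AG'; left.
  by move=> /(_ _ G'b) Ab; apply: nb; exists d; left.
have [h hP] := choice total; have [_ AB Afun] := PA.
have huniq b d : (A `|` G) (b, d) -> h b = d.
  move=> Abd; apply/eqP; rewrite -subr_eq0; apply/eqP/Afun.
  by rewrite -(subrr b); exact: (AB _ _ (hP b) Abd).
have hadd : zmod_morphism h.
  by move=> x y; apply: huniq; exact: (AB _ _ (hP x) (hP y)).
pose hM := GRing.isZmodMorphism.Build B QmodZ h hadd.
pose hh : {additive B -> QmodZ} := HB.pack h hM.
by exists hh => b d Gbd; apply: huniq; right.
Qed.

Lemma character_separates (x : B) : x != 0 -> exists h : {additive B -> QmodZ}, h x != 0.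
Proof.
move=> x0.
have [q [q0 qP]] : exists q : QmodZ, q != 0 /\ forall k, x *~ k = 0 -> q *~ k = 0.
  pose P n := (0 < n)%N && (x *+ n == 0).
  have [exP|nexP] := pselect (exists n, P n).
    have [n /andP[n0 /eqP nx0] nmin] := ex_minnP exP.
    have n1 : (1 < n)%N.
      by rewrite ltn_neqAle n0 andbT eq_sym; apply: contraNneq x0 => n1; rewrite -nx0 n1.
    exists (to_QmodZ (n%:R^-1)); split.
      apply/eqP => /to_QmodZ_eq0 /intrP[m /(congr1 ( *%R n%:R))].
      rewrite divff ?pnatr_eq0 -?lt0n // pmulrn -intrM => nm1.
      have {}nm1 : n%:Z * m = 1 by apply: (@intr_inj rat); rewrite -nm1.
      have : (n%:Z %| 1)%Z by have := dvdz_mulr m (dvdzz n%:Z); rewrite nm1.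
      by rewrite dvdzE /= dvdn1 => /eqP n1'; rewrite n1' in n1.
    move=> k kx0; rewrite to_QmodZ_mulrz; apply/to_QmodZ_eq0.
    suff /dvdzP[m ->] : (n%:Z %| k)%Z.
      by rewrite mulrC mulrzA -pmulrn -[_ *+ n]mulr_natr mulVf ?pnatr_eq0 -?lt0n // intr_int.
    have kE := divz_eq k n; apply/dvdz_mod0P.
    have : x *~ (k %% n)%Z = 0.
      by move: kx0; rewrite {1}kE mulrzDr mulrC mulrzA -pmulrn nx0 mul0rz add0r.
    have : (k %% n)%Z >= 0 by rewrite modz_ge0 // eqz_nat -lt0n.
    have : (k %% n)%Z < n by rewrite ltz_pmod.
    case: (k %% n)%Z => // r rn _ /eqP xr.
    congr Posz; apply/eqP; rewrite -leqn0 leqNgt; apply/negP => r0.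
    suff : (n <= r)%N by rewrite leqNgt -ltz_nat rn.
    by apply: nmin; rewrite /P r0.
  exists (to_QmodZ (2%:R^-1)); split.
    apply/eqP => /to_QmodZ_eq0 /intrP[m /(congr1 ( *%R 2%:R))].
    rewrite divff // pmulrn -intrM => nm1.
    have {}nm1 : 2%:Z * m = 1 by apply: (@intr_inj rat); rewrite -nm1.
    have : (2%:Z %| 1)%Z by have := dvdz_mulr m (dvdzz 2%:Z); rewrite nm1.
    by [].
  move=> k; have [k0|k0|->] := ltrgt0P k => // kx0; case: nexP; exists `|k|%N.
    by rewrite /P absz_gt0 gt_eqF //= pmulrn gtz0_abs // kx0.
  by rewrite /P absz_gt0 lt_eqF //= pmulrn ltz0_abs // mulrNz kx0 oppr0.
have [] := @partial_additive_extend [set p | exists k, p = (x *~ k, q *~ k)].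
  split.
  - by exists 0.
  - by move=> _ _ [k ->] [l ->]; exists (k - l); rewrite !mulrzBr.
  - by move=> d [k [/esym/qP + ->]].
by move=> h hP; exists h; rewrite (hP x q) //; exists 1.
Qed.

End Extension.
End Characters.

Section Hull.
Variables (R : pzRingType) (M : lmodType R).

Definition coinduced : {pred {additive M -> QmodZ} -> R -> QmodZ} :=
  fun f => `[< forall chi, zmod_morphism (f chi) >].
Fact coinduced_closed : zmod_closed coinduced.
Proof.
split; first by apply/asboolP => chi x y; rewrite subr0.
move=> f g /asboolP fP /asboolP gP; apply/asboolP => chi x y.
by rewrite -![(f - g) _ _]/(f chi _ - g chi _) fP gP !opprD !opprK addrACA.
Qed.
HB.instance Definition _ := GRing.isZmodClosed.Build _ coinduced coinduced_closed.

Definition hull := {f : {additive M -> QmodZ} -> R -> QmodZ | f \in coinduced}.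
HB.instance Definition _ := SubChoice.on hull.
HB.instance Definition _ := [SubChoice_isSubZmodule of hull by <:].

Lemma hull_ext (f g : hull) : (forall chi r, val f chi r = val g chi r) -> f = g.
Proof. by move=> fg; apply: val_inj; apply/funext => chi; apply/funext => r. Qed.
Lemma hullB (f : hull) chi x y : val f chi (x - y) = val f chi x - val f chi y.
Proof. by have /asboolP := valP f; apply. Qed.
Lemma hullD (f : hull) chi x y : val f chi (x + y) = val f chi x + val f chi y.
Proof.
have f0 : val f chi 0 = 0 by rewrite -(subrr 0) hullB subrr.
by rewrite -[y in LHS]opprK hullB -[- y]sub0r hullB f0 sub0r opprK.
Qed.

Fact hull_scale_subproof a (f : hull) : (fun chi r => val f chi (r * a)) \in coinduced.
Proof. by apply/asboolP => chi x y; rewrite mulrBl hullB. Qed.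
Definition hull_scale a (f : hull) : hull := Sub (fun chi r => val f chi (r * a)) (hull_scale_subproof a f).

Fact hull_scaleA a b f : hull_scale a (hull_scale b f) = hull_scale (a * b) f.
Proof. by apply: hull_ext => chi r /=; rewrite mulrA. Qed.
Fact hull_scale1 : left_id 1 hull_scale.
Proof. by move=> f; apply: hull_ext => chi r /=; rewrite mulr1. Qed.
Fact hull_scaleDr : right_distributive hull_scale +%R.
Proof. by move=> a f g; apply: hull_ext. Qed.
Fact hull_scaleDl f : {morph hull_scale^~ f : a b / a + b}.
Proof. by move=> a b; apply: hull_ext => chi r /=; rewrite mulrDr hullD. Qed.
HB.instance Definition _ := GRing.Zmodule_isLmodule.Build R hull
  hull_scaleA hull_scale1 hull_scaleDr hull_scaleDl.

Fact to_hull_subproof m : (fun (chi : {additive M -> QmodZ}) r => chi (r *: m)) \in coinduced.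
Proof. by apply/asboolP => chi x y; rewrite scalerBl raddfB. Qed.
Definition to_hull m : hull := Sub (fun (chi : {additive M -> QmodZ}) r => chi (r *: m)) (to_hull_subproof m).
Fact to_hull_linear : linear to_hull.
Proof.
move=> a u v; apply: hull_ext => chi r /=.
by rewrite scalerDr raddfD scalerA.
Qed.
HB.instance Definition _ := GRing.isLinear.Build R M hull _ to_hull to_hull_linear.

Lemma to_hull_inj : injective to_hull.
Proof.
move=> u v uv; apply/eqP; rewrite -subr_eq0; apply: contraT => /character_separates[chi].
have /(congr1 (fun f : hull => val f chi 1)) /= := uv.
by rewrite !scale1r raddfB => ->; rewrite subrr eqxx.
Qed.

Lemma hull_injective : injective_module hull.
Proof.
move=> A B i f i_inj.
have ext chi : exists h : {additive B -> QmodZ}, forall a, h (i a) = val (f a) chi 1.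
  have [|h hP] := @partial_additive_extend B
      [set p | exists a, p = (i a, val (f a) chi 1)]; last first.
    by exists h => a; apply: hP; exists a.
  split.
  - by exists 0; rewrite !linear0.
  - by move=> _ _ [a ->] [b ->]; exists (a - b); rewrite !linearB.
  - move=> d [a [/esym ia0 ->]].
    have -> : a = 0 by apply: i_inj; rewrite ia0 linear0.
    by rewrite linear0.
have [h hP] := choice ext.
have gP b : (fun chi (r : R) => h chi (r *: b)) \in coinduced.
  by apply/asboolP => chi x y; rewrite scalerBl raddfB.
pose g b : hull := Sub (fun chi r => h chi (r *: b)) (gP b).
have g_linear : linear g.
  by move=> a u v; apply: hull_ext => chi r /=; rewrite scalerDr raddfD scalerA.
pose gM := GRing.isLinear.Build R B hull _ g g_linear.
pose gg : {linear B -> hull} := HB.pack g gM.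
exists gg => a; apply: hull_ext => chi r /=.
by rewrite -linearZ hP linearZ /= mul1r.
Qed.

End Hull.

Section Resolution.
Variable R : pzRingType.

Section Image.
Variables (A B : lmodType R) (f : {linear A -> B}).
Definition linear_image : {pred B} := fun y => `[< exists x, y = f x >].
Fact linear_image_closed : subsemimod_closed linear_image.
Proof.
split; first split.
- by apply/asboolP; exists 0; rewrite linear0.
- move=> _ _ /asboolP[x ->] /asboolP[y ->]; apply/asboolP.
  by exists (x + y); rewrite linearD.
- by move=> a _ /asboolP[x ->]; apply/asboolP; exists (a *: x); rewrite linearZ.
Qed.
HB.instance Definition _ := GRing.isSubmodClosed.Build R B linear_image linear_image_closed.

Definition coker_hull := hull (quot_module linear_image).
Definition to_coker_hull : {linear B -> coker_hull} :=
  @to_hull R (quot_module linear_image) \o @to_quotient R B linear_image.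

Lemma to_coker_hull_eq0 y : to_coker_hull y = 0 <-> exists x, y = f x.
Proof.
split=> [/= y0|[x ->] /=].
  suff : y - 0 \in linear_image by rewrite subr0 => /asboolP.
  by apply/to_quotient_eq; rewrite [RHS]linear0; apply: to_hull_inj; rewrite y0 linear0.
rewrite (_ : to_quotient _ _ = 0) ?linear0 //.
rewrite -[RHS](linear0 (@to_quotient R B linear_image)); apply/to_quotient_eq.
by rewrite subr0; apply/asboolP; exists x.
Qed.

End Image.

Record arrow := Arrow {
  source : lmodType R;
  target : lmodType R;
  arrow_map :> {linear source -> target}
}.

Variable M : lmodType R.

(* 0 -> M -> E^0 -> E^1 -> ..., where E^(n+1) is the hull of the cokernel of
   the previous arrow. *)
Fixpoint resolution_arrow n : arrow :=
  match n with
  | 0 => Arrow (@to_hull R M)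
  | m.+1 => Arrow (to_coker_hull (resolution_arrow m))
  end.

Fact resolution_diffK n x :
  resolution_arrow n.+2 (resolution_arrow n.+1 x) = 0.
Proof. by apply/to_coker_hull_eq0; exists x. Qed.

Definition resolution_complex := @CochainComplex R
  (fun n => target (resolution_arrow n)) (fun n => resolution_arrow n.+1)
  resolution_diffK.

Definition resolution : injective_resolution M.
Proof.
refine (@InjectiveResolution R M resolution_complex (@to_hull R M) _ _ _ _).
- by case=> [|n]; exact: hull_injective.
- exact: to_hull_inj.
- by move=> x; exact: to_coker_hull_eq0.
- by move=> n x; exact: (to_coker_hull_eq0 (resolution_arrow n.+1)).
Defined.

End Resolution.

(* Any other injective resolution of M gives the same module up to
   isomorphism. *)
Definition right_derived (R : pzRingType) (F : mod_functor R) (i : nat)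
    (M : lmodType R) : lmodType R :=
  cohomology (fmap_complex F (resolution M)) i.

(* Ordinary local cohomology with respect to an ideal a is the case I = a and
   J = zero_ideal. *)
Definition local_cohomology (R : comPzRingType) (I J : ideal R) (i : nat)
    (M : lmodType R) : lmodType R :=
  right_derived (Gamma I J) i M.

(* Main.v *)
(* Write A = Gamma_a(E) and G = Gamma_{I,J}(E) for the injective resolution E of
   M; since a lies in W~(I,J), A is a subcomplex of G. Over a Noetherian ring the
   modules G^i and A^i are again injective. As G is exact below t, its
   coboundaries B^i are injective for i <= t, so the surjection G^{t-1} -> B^t
   splits and every a-torsion element of B^t is the image of an a-torsion element:
   H^t_a(M) embeds into H^t_{I,J}(M), and likewise H^i_a(M) = 0 for i < t. This
   gives the statement on radicals. Let c be the annihilator of H^t_a(M). The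
   coboundaries of A in degree t are injective too, so every class in H^t_a(M) is
   represented by a cocycle killed by c; hence H^t_a(M) is a quotient of
   Ext^t(R/c, M), which is finitely generated by dimension shifting. *)

Require Import Defs.
From HB Require Import structures.
From mathcomp Require Import all_boot all_order all_algebra.
From mathcomp Require Import boolp classical_sets.

Set Implicit Arguments.
Unset Strict Implicit.
Unset Printing Implicit Defensive.

Import GRing.Theory.

Local Open Scope ring_scope.

(** * Submodules as predicates, and finite generation *)

Section IsSubmod.
Variables (R : comPzRingType) (V : lmodType R).
Implicit Types (P : V -> Prop) (s : seq V).

(** Predicates into [Prop] let kernels, images and unions be written as plain formulas; [submod_of]
    leads back to the bundled [submodClosed]. *)
Definition is_submod P := P 0 /\ forall a u v, P u -> P v -> P (a *: u + v).

Lemma is_submodD P u v : is_submod P -> P u -> P v -> P (u + v).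
Proof. by move=> [_ PL] Pu Pv; rewrite -[u]scale1r; exact: PL. Qed.

Lemma is_submodZ P a u : is_submod P -> P u -> P (a *: u).
Proof. by move=> [P0 PL] Pu; rewrite -[_ *: _]addr0; exact: PL. Qed.

Lemma is_submodN P u : is_submod P -> P u -> P (- u).
Proof. by move=> PP Pu; rewrite -scaleN1r; exact: is_submodZ. Qed.

Lemma is_submodB P u v : is_submod P -> P u -> P v -> P (u - v).
Proof. by move=> PP Pu Pv; apply: is_submodD => //; exact: is_submodN. Qed.

Lemma is_submod_sum P (I : finType) (F : I -> V) :
  is_submod P -> (forall i, P (F i)) -> P (\sum_i F i).
Proof.
move=> PP PF; elim/big_ind: _ => //; first by case: PP.
by move=> u v; exact: is_submodD.
Qed.

Fact is_submod_closed P : is_submod P -> subsemimod_closed (fun v => `[< P v >]).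
Proof.
move=> PP; split; first split.
- by apply/asboolP; case: PP.
- by move=> u v /asboolP Pu /asboolP Pv; apply/asboolP; exact: is_submodD.
- by move=> a v /asboolP Pv; apply/asboolP; exact: is_submodZ.
Qed.

Definition submod_of P (PP : is_submod P) : submodClosed V :=
  let p : V -> bool := fun v => `[< P v >] in
  HB.pack p (GRing.isSubmodClosed.Build R V p (is_submod_closed PP)).

Lemma submod_ofP P (PP : is_submod P) v : reflect (P v) (v \in submod_of PP).
Proof. exact: asboolP. Qed.

Lemma submodClosed_is_submod (N : submodClosed V) : is_submod (fun v => v \in N).
Proof. by split=> [|a u v Nu Nv]; rewrite ?rpred0 // rpredD // rpredZ. Qed.

(** Turns membership in a generated submodule into an induction principle over linear properties. *)
Lemma generatedP s v :
  v \in generated [set` s]%classic <->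
  (forall P, is_submod P -> (forall w, w \in s -> P w) -> P v).
Proof.
split=> [/asboolP sv P PP sP|sv].
  by apply/(submod_ofP PP)/sv => w ws; apply/submod_ofP/sP.
apply/asboolP => N sN; exact: (sv _ (submodClosed_is_submod N)).
Qed.

Definition fg_submod P :=
  exists s, (forall v, v \in s -> P v) /\
    forall v, P v -> forall Q, is_submod Q -> (forall w, w \in s -> Q w) -> Q v.

End IsSubmod.

(** * Relative injectivity and Baer's criterion *)

Section LinRel.
Variables (R : comPzRingType) (X V : lmodType R).
Implicit Type T : X -> V -> Prop.

(** With [functional], the graph of a linear map defined on some submodule of [X]. *)
Definition linrel T :=
  T 0 0 /\ forall a x v y w, T x v -> T y w -> T (a *: x + y) (a *: v + w).

Definition functional T := forall v, T 0 v -> v = 0.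

Lemma linrelZ T a x v : linrel T -> T x v -> T (a *: x) (a *: v).
Proof.
by move=> [T0 TL] Tx; rewrite -[a *: x]addr0 -[a *: v]addr0; exact: TL.
Qed.

Lemma linrelB T x v y w : linrel T -> T x v -> T y w -> T (x - y) (v - w).
Proof.
move=> [_ TL] Tx Ty; have := TL (-1) _ _ _ _ Ty Tx.
by rewrite !scaleN1r ![- _ + _]addrC.
Qed.

Lemma functional_uniq T x v w :
  linrel T -> functional T -> T x v -> T x w -> v = w.
Proof.
move=> TT Tf Tv Tw; apply/eqP; rewrite -subr_eq0; apply/eqP/Tf.
by rewrite -(subrr x); exact: linrelB.
Qed.

End LinRel.

Section RelInjective.
Variables (R : comPzRingType) (V : lmodType R) (N : V -> Prop).

(** Injectivity of the submodule [N]. Partial maps are graphs, so neither [N] nor the domain of the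
    map has to be made into a type. *)
Definition rel_injective := forall (X : lmodType R) (T : X -> V -> Prop),
  linrel T -> functional T -> (forall x v, T x v -> N v) ->
  exists2 g : {linear X -> V}, (forall x, N (g x)) &
    forall x v, T x v -> g x = v.

Definition baer := forall T : R^o -> V -> Prop,
  linrel T -> functional T -> (forall x v, T x v -> N v) ->
  exists2 e, N e & forall r v, T r v -> v = r *: e.

Lemma rel_injective_baer : rel_injective -> baer.
Proof.
move=> inj T TT Tf TN; have [g gN gT] := inj _ T TT Tf TN.
exists (g 1) => // r v /gT <-; rewrite -linearZ; congr (g _).
by rewrite -[r in LHS]mulr1.
Qed.

Section Baer.
Hypotheses (NN : is_submod N) (bN : baer).
Variables (X : lmodType R).

Let good (T : set (X * V)) :=
  [/\ linrel (fun x v => T (x, v)), functional (fun x v => T (x, v)) &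
    forall x v, T (x, v) -> N v].

(** The [r] with [r *: x] in the domain of [T] form an ideal. Baer's condition makes the map on it
    multiplication by some [e] in [N], so sending [x] to [e] is consistent with [T]. *)
Lemma baer_step T x : good T ->
  exists2 T', good T' & (T `<=` T')%classic /\ exists v, T' (x, v).
Proof.
move=> [TT Tf TN].
have [e eN eT] : exists2 e, N e & forall r v, T (r *: x, v) -> v = r *: e.
  apply: (bN (T := fun (r : R^o) v => T ((r : R) *: x, v))).
  - split; first by rewrite scale0r; case: TT.
    move=> a r v r' v' Tr Tr'; case: (TT) => _ TL; have := TL a _ _ _ _ Tr Tr'.
    by rewrite scalerA -scalerDl.
  - by move=> v; rewrite scale0r; exact: Tf.
  - by move=> r v; exact: TN.
exists (fun p => exists y v r, T (y, v) /\ p = (y + r *: x, v + r *: e)).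
  split.
  - split.
      by exists 0, 0, 0; rewrite !scale0r !addr0; split=> //; case: TT.
    move=> a _ _ _ _ [y [v [r [Ty [-> ->]]]]] [z [w [r' [Tz [-> ->]]]]].
    exists (a *: y + z), (a *: v + w), (a * r + r'); split.
      by case: TT => _; apply.
    by rewrite !scalerDr !scalerA !scalerDl; congr (_, _); rewrite addrACA.
  - move=> _ [y [v [r [Ty [/esym/eqP yr ->]]]]].
    move: Ty; rewrite addr_eq0 in yr; rewrite (eqP yr) -scaleNr => /eT ->.
    by rewrite scaleNr addNr.
  - move=> _ _ [y [v [r [/TN Nv [_ ->]]]]].
    by apply: is_submodD => //; exact: is_submodZ.
split=> [[y v] Ty|]; first by exists y, v, 0; rewrite !scale0r !addr0.
by exists e, 0, 0, 1; rewrite !scale1r !add0r; split=> //; case: TT.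
Qed.

Lemma baer_extend T : good T ->
  exists2 g : {linear X -> V}, (forall x, N (g x)) &
    forall x v, T (x, v) -> g x = v.
Proof.
move=> TT.
(* Zorn's lemma is applied to the sets [A] whose union with [T] is good: the empty chain has empty
   union, which is not itself a good graph. *)
have [F FP Ftot|A [PA Amax]] := @Zorn_bigcup _ (fun A => good (A `|` T)%classic).
  have chain p q : ((\bigcup_(Y in F) Y) `|` T)%classic p ->
      ((\bigcup_(Y in F) Y) `|` T)%classic q ->
      exists Z, [/\ good Z, Z p, Z q &
        (Z `<=` (\bigcup_(Y in F) Y) `|` T)%classic].
    have sub Y : F Y -> (Y `|` T `<=` (\bigcup_(Y in F) Y) `|` T)%classic.
      by move=> FY r [Yr|Tr]; [left; exists Y|right].
    move=> [[Y FY Yp]|Tp] [[Z FZ Zq]|Tq].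
    - have [YZ|ZY] := Ftot _ _ FY FZ.
        by exists (Z `|` T)%classic; split; [exact: FP|left; exact: YZ|left|exact: sub].
      by exists (Y `|` T)%classic; split; [exact: FP|left|left; exact: ZY|exact: sub].
    - by exists (Y `|` T)%classic; split; [exact: FP|left|right|exact: sub].
    - by exists (Z `|` T)%classic; split; [exact: FP|right|left|exact: sub].
    - by exists T; split=> // r Tr; right.
  split.
  - split; first by right; case: TT => -[].
    move=> a x v y w /chain /[apply] -[Z [[[_ ZL] _ _] Zp Zq]]; apply.
    exact: ZL.
  - by move=> v Uv; have [Z [[_ Zf _] Zv _ _]] := chain _ _ Uv Uv; exact: Zf.
  - by move=> x v Uv; have [Z [[_ _ ZN] Zv _ _]] := chain _ _ Uv Uv; exact: (ZN x).
have total x : exists v, (A `|` T)%classic (x, v).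
  apply: contrapT => nx; have [T' gT' [AT' [v T'x]]] := baer_step x PA.
  apply: (Amax T'); last first.
    by rewrite setUidl // => z Tz; apply: AT'; right.
  split; first by move=> z Az; apply: AT'; left.
  by move=> /(_ _ T'x) Ax; apply: nx; exists v; left.
have [h hP] := choice total; have [AA Af AN] := PA.
have h_linear : linear h.
  move=> a x y; apply: (functional_uniq AA Af); first exact: hP.
  by case: AA => _; apply; exact: hP.
pose hM := GRing.isLinear.Build R X V _ h h_linear.
pose hh : {linear X -> V} := HB.pack h hM.
exists hh => [x|x v Tx]; first exact: (AN x).
by apply: (functional_uniq AA Af) (hP x) _; right.
Qed.

End Baer.

Lemma baer_rel_injective : is_submod N -> baer -> rel_injective.
Proof.
move=> NN bN X T TT Tf TN.
exact: (baer_extend NN bN (T := fun p => T p.1 p.2)).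
Qed.

End RelInjective.

(** The graph [T], as a submodule of the product, is the source of the extension problem: its first
    projection is injective because [T] is functional, and its second projection is the map to
    extend. *)
Lemma injective_rel_injective (R : comPzRingType) (E : lmodType R) :
  injective_module E -> rel_injective (fun _ : E => True).
Proof.
move=> injE X T TT Tf _.
have PP : is_submod (fun p : (X * E)%type => T p.1 p.2).
  by split=> [|a u v]; [case: TT|case: TT => _; exact].
pose A : lmodType R := submodule (submod_of PP).
pose i : {linear A -> X} := fst \o (val : {linear A -> (X * E)%type}).
pose f : {linear A -> E} := snd \o (val : {linear A -> (X * E)%type}).
have [|g gP] := injE A X i f.
  move=> [u Tu] [v Tv] /= uv; apply: val_inj => /=.
  have /submod_ofP Tu' := Tu; have /submod_ofP Tv' := Tv.
  case: u v uv Tu' Tv' {Tu Tv} => [x1 x2] [y1 y2] /= -> Tx Ty.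
  by rewrite (functional_uniq TT Tf Tx Ty).
exists g => // x v Tx.
have Tin : (x, v) \in submod_of PP by apply/submod_ofP.
exact: (gP (Sub (x, v) Tin : A)).
Qed.

(** * Noetherian rings and (I,J)-torsion *)

Lemma ideal_mull (R : comPzRingType) (I : ideal R) (r : R) (x : R^o) :
  x \in I -> (r * x : R) \in I.
Proof. exact: (@rpredZ R R^o I r x). Qed.

Section Noetherian.
Variables (R : comPzRingType) (noethR : noetherian R).

Lemma noetherian_fg (P : R^o -> Prop) : is_submod P -> fg_submod P.
Proof.
move=> PP; have [s sP] := noethR (submod_of PP); exists s.
split=> [v vs|v /(submod_ofP PP)].
  apply/(submod_ofP PP); rewrite sP; apply/generatedP => Q _; exact.
by rewrite sP => /generatedP.
Qed.

(** Without a maximal element, choice yields a strictly ascending chain. Its union is an ideal whose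
    finitely many generators all lie in one [c n], so [c n.+1] is no larger than [c n]. *)
Lemma ideal_max (F : (R^o -> Prop) -> Prop) P0 :
    F P0 -> (forall P, F P -> is_submod P) ->
  exists2 P, F P & forall Q, F Q -> (forall x, P x -> Q x) -> forall x, Q x -> P x.
Proof.
move=> F0 FS; apply: contrapT => nmax.
have step P : exists Q, F P ->
    [/\ F Q, forall x, P x -> Q x & exists x, Q x /\ ~ P x].
  have [FP|] := pselect (F P); last by exists P.
  apply: contrapT => nQ; apply: nmax; exists P => // Q FQ PQ x Qx.
  by apply: contrapT => nPx; apply: nQ; exists Q => _; split=> //; exists x.
have [next nextP] := choice step.
pose c n := iter n next P0.
have Fc n : F (c n) by elim: n => //= n /nextP[].
have c_mono m n x : (m <= n)%N -> c m x -> c n x.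
  move=> /subnK <-; elim: (n - m)%N => //= k IHk /IHk.
  by have [_ +_] := nextP _ (Fc (k + m)%N); exact.
have c_submod n := FS _ (Fc n).
have US : is_submod (fun x => exists n, c n x).
  split; first by exists 0%N; case: (c_submod 0%N).
  move=> a x y [m mx] [n ny]; exists (maxn m n); case: (c_submod (maxn m n)) => _.
  by apply; [apply: c_mono mx|apply: c_mono ny]; rewrite ?leq_maxl ?leq_maxr.
have [s [sU Us]] := noetherian_fg US.
have [n sn] : exists n, forall x, x \in s -> c n x.
  elim: s sU {Us} => [|x s IHs] sU; first by exists 0%N.
  have [n sn] : exists n, forall x, x \in s -> c n x.
    by apply: IHs => y ys; apply: sU; rewrite inE ys orbT.
  have [m mx] := sU x (mem_head _ _); exists (maxn m n) => y.
  rewrite inE => /predU1P[->|/sn]; first by apply: c_mono mx; exact: leq_maxl.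
  by apply: c_mono; exact: leq_maxr.
have [_ _ [x [cx ncx]]] := nextP _ (Fc n); apply: ncx.
by apply: (Us x) => //; exists n.+1.
Qed.

Lemma ideal_exp_prod (I : ideal R) n (f : 'I_n -> R^o) :
  (forall i, f i \in I) -> \prod_i (f i : R) \in ideal_exp I n.
Proof. by move=> fI; apply/asboolP => N; apply; exists f. Qed.

Lemma ideal_exp_expr (I : ideal R) n (x : R^o) :
  x \in I -> (x : R) ^+ n \in ideal_exp I n.
Proof.
move=> xI; rewrite -[in X in _ ^+ X](card_ord n) -prodr_const.
exact: (ideal_exp_prod (f := fun=> x)).
Qed.

Lemma ideal_exp_sub (I : ideal R) n (P : R^o -> Prop) : is_submod P ->
  (forall f : 'I_n -> R^o, (forall i, f i \in I) -> P (\prod_i (f i : R))) ->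
  forall x, x \in ideal_exp I n -> P x.
Proof.
move=> PP fP x /asboolP xI; apply/(submod_ofP PP)/xI => _ [f fI ->].
exact/submod_ofP/fP.
Qed.

(* Noetherian induction on P: if u in I is not in P but u^2 is, then
   (P + (u))^2 is contained in P. *)
Lemma ideal_exp_sub_radical (I : ideal R) (P : R^o -> Prop) : is_submod P ->
    (forall x, x \in I -> exists n, P ((x : R) ^+ n)) ->
  exists2 n, (0 < n)%N & forall x, x \in ideal_exp I n -> P x.
Proof.
move=> PP PI; pose good (Q : R^o -> Prop) := exists2 n, (0 < n)%N &
  forall x, x \in ideal_exp I n -> Q x.
apply: contrapT => bad.
have [Q [QQ PQ badQ] Qmax] := @ideal_max (fun Q =>
  [/\ is_submod Q, forall x, P x -> Q x & ~ good Q]) P (And3 PP (fun x H => H) bad)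
  (fun Q H => let: And3 QQ _ _ := H in QQ).
have [u [uI nQu Qu2]] : exists u : R^o, [/\ u \in I, ~ Q u & Q ((u : R) * u)].
  have [u [uI nQu]] : exists u : R^o, u \in I /\ ~ Q u.
    apply: contrapT => nu; apply: badQ; exists 1%N => //.
    apply: ideal_exp_sub => // f fI; rewrite big_ord_recl big_ord0 mulr1.
    by apply: contrapT => nQf; apply: nu; exists (f ord0).
  (* For the least [n] with u^n in [Q], which is at least 2, the power u^(n-1) is outside [Q] while
     its square is inside, as 2(n-1) >= n. *)
  have exn : exists n, `[< Q ((u : R) ^+ n) >].
    by have [n Pn] := PI u uI; exists n; apply/asboolP/PQ.
  case: (ex_minnP exn) => -[|[|n]] /asboolP Qn nmin.
  - by case: nQu; rewrite -[u](mulr1 (u : R)); exact: (is_submodZ u QQ Qn).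
  - by case: nQu; rewrite expr1 in Qn.
  exists ((u : R) ^+ n.+1); split.
  - by rewrite exprSr; exact: ideal_mull.
  - by move=> /asboolP/nmin; rewrite ltnn.
  - by rewrite -exprD addSnnS exprD; exact: (is_submodZ ((u : R) ^+ n) QQ Qn).
pose Q' (x : R^o) := exists q r, Q q /\ x = q + r * u.
have Q'Q' : is_submod Q'.
  split; first by exists 0, 0; rewrite mul0r addr0; case: QQ.
  move=> a _ _ [q [r [Qq ->]]] [q' [r' [Qq' ->]]].
  exists (a *: q + q'), (a * r + r'); split; first by case: QQ => _; exact.
  by rewrite scalerDr mulrDl -mulrA addrACA.
apply: nQu; apply: (Qmax Q').
- split=> // [x /PQ Qx|[n n0 nQ']]; first by exists x, 0; rewrite mul0r addr0.
  (* If I^n lay in [Q'], then I^(n+n) would lie in the square of [Q'], hence in [Q]. *)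
  apply: badQ; exists (n + n)%N; first by rewrite addn_gt0 n0.
  apply: ideal_exp_sub => // f fI; rewrite big_split_ord /=.
  have [q [r [Qq ->]]] : Q' (\prod_i (f (lshift n i) : R)).
    by apply/nQ'/ideal_exp_prod => i; exact: fI.
  have [q' [r' [Qq' ->]]] : Q' (\prod_i (f (rshift n i) : R)).
    by apply/nQ'/ideal_exp_prod => i; exact: fI.
  have -> : (q + r * u) * (q' + r' * u) =
      (q' + r' * u) *: q + (r * u) *: q' + (r * r') *: ((u : R) * u : R^o).
    by rewrite mulrDl [q * _]mulrC [r * u * _]mulrDr mulrACA addrA.
  exact: is_submodD QQ (is_submodD QQ (is_submodZ _ QQ Qq) (is_submodZ _ QQ Qq'))
    (is_submodZ _ QQ Qu2).
- by move=> x Qx; exists x, 0; rewrite mul0r addr0.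
- by exists 0, 1; rewrite mul1r add0r; split=> //; case: QQ.
Qed.

End Noetherian.

Section NoetherianTorsion.
Variables (R : comPzRingType) (noethR : noetherian R) (I J : ideal R).

(** The scalars acting on [x] like an element of [J] form an ideal, and over a Noetherian ring it
    contains a power of [I] as soon as it contains a power of each element of [I]. Torsion can thus
    be checked one [r] at a time. *)
Lemma torsionP (X : lmodType R) (x : X) : x \in @torsion R I J X <->
  forall r : R^o, r \in I -> exists n b, b \in J /\ (r : R) ^+ n *: x = b *: x.
Proof.
split=> [/asboolP[n _ nx] r rI|xI].
  have [b bJ bx] := nx _ (ideal_exp_expr n rI).
  by exists n, b.
apply/asboolP; apply: (ideal_exp_sub_radical noethR
  (P := fun a : R^o => exists2 b, b \in J & a *: x = b *: x)).
  split; first by exists 0; rewrite ?rpred0.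
  move=> r a a' [b bJ ax] [b' b'J a'x]; exists (r *: b + b').
    by rewrite rpredD // rpredZ.
  by rewrite !scalerDl -!scalerA ax a'x.
by move=> r /xI[n [b [bJ nx]]]; exists n, b.
Qed.

Lemma W_tilde_radical (a : ideal R) : W_tilde I J a ->
  forall r : R^o, r \in I -> exists n s b,
    [/\ s \in a, b \in J & (r : R) ^+ n = s + b].
Proof.
move=> [n _ nI] r /(ideal_exp_expr n)/nI/asboolP[s [b [sa bJ rE]]].
by exists n, s, b.
Qed.

End NoetherianTorsion.

Lemma torsion0P (R : comPzRingType) (noethR : noetherian R) (a : ideal R)
    (X : lmodType R) (x : X) : x \in @torsion R a zero_ideal X <->
  forall r : R^o, r \in a -> exists n, (r : R) ^+ n *: x = 0.
Proof.
split=> [/(torsionP noethR) xa r /xa[n [b [/eqP b0 nx]]]|xa].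
  by exists n; rewrite nx b0 scale0r.
apply/(torsionP noethR) => r /xa[n nx]; exists n, 0.
by rewrite rpred0 scale0r.
Qed.

Lemma expr_addr_mod (R : comPzRingType) (J : ideal R) (x b : R) n :
  b \in J -> exists2 c, c \in J & (x + b) ^+ n = x ^+ n + c.
Proof.
move=> bJ; elim: n => [|n [c cJ IHn]]; first by exists 0; rewrite ?rpred0 ?addr0.
exists (b * x ^+ n + (x + b) * c); last first.
  by rewrite exprS IHn mulrDr mulrDl -exprS addrA.
apply: rpredD; last exact: ideal_mull.
by rewrite mulrC; exact: ideal_mull.
Qed.

(** If r^n = s + b with [s] in [a] and [b] in [J], and s^m kills [x], then r^(nm) is s^m modulo [J]
    and acts on [x] like an element of [J]. *)
Lemma torsion_W_tilde (R : comPzRingType) (noethR : noetherian R)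
    (I J a : ideal R) (aW : W_tilde I J a) (X : lmodType R) (x : X) :
  x \in @torsion R a zero_ideal X -> x \in @torsion R I J X.
Proof.
move=> /(torsion0P noethR) xa; apply/(torsionP noethR) => r rI.
have [n [s [b [sa bJ nE]]]] := W_tilde_radical aW rI.
have [m mx] := xa s sa; have [c cJ cE] := expr_addr_mod s m bJ.
by exists (n * m)%N, c; rewrite exprM nE cE scalerDl mx add0r.
Qed.

(** * Torsion submodules of injective modules *)

Section TorsionInjective.
Variables (R : comPzRingType) (noethR : noetherian R) (E : lmodType R).
Hypothesis injE : injective_module E.

(* An element y killing the range of T acts nilpotently modulo an ideal K
   maximal with K :&: dom T = ker T, so T may be extended by zero on K. *)
Lemma linrel_extend (T : R^o -> E -> Prop) : linrel T -> functional T ->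
  exists2 e, forall r v, T r v -> v = r *: e &
    forall y : R, (forall r v, T r v -> y *: v = 0) -> exists n, y ^+ n *: e = 0.
Proof.
move=> TT Tf; have [T0 TL] := TT.
pose F (L : R^o -> Prop) := [/\ is_submod L, forall r, T r 0 -> L r &
  forall r v, L r -> T r v -> T r 0].
have [K [KK kerK Kker] Kmax] : exists2 K, F K &
    forall Q, F Q -> (forall x, K x -> Q x) -> forall x, Q x -> K x.
  apply: (ideal_max noethR (P0 := fun r => T r 0)); last by move=> L [].
  split=> //; split=> // a u v Tu Tv.
  by have := TL a _ _ _ _ Tu Tv; rewrite scaler0 addr0.
(* The map of [T] extended by zero on [K]; it is well defined because [K] meets the domain of [T]
   inside its kernel. *)
have [e _ eT] : exists2 e : E, True &
    forall r v, (exists2 k, K k & T (r - k) v) -> v = r *: e.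
  apply: (rel_injective_baer (injective_rel_injective injE)) => //.
    split; first by exists 0; rewrite ?subr0 //; case: KK.
    move=> a r v r' v' [k Kk Tr] [k' Kk' Tr']; exists (a *: k + k').
      by case: KK => _; apply.
    by rewrite opprD addrACA -scalerBr; exact: TL.
  move=> v [k Kk]; rewrite sub0r => Tv.
  exact: (functional_uniq TT Tf Tv (Kker _ _ (is_submodN KK Kk) Tv)).
exists e => [r v Tr|y yT].
  by apply: eT; exists 0; rewrite ?subr0 //; case: KK.
suff [n Kn] : exists n, K (y ^+ n).
  by exists n; rewrite -(eT _ 0) //; exists (y ^+ n); rewrite ?subrr.
have chainS n : is_submod (fun r : R^o => K (y ^+ n * r)).
  split=> [|a u v Ku Kv]; first by rewrite mulr0; case: KK.
  have -> : y ^+ n * (a *: u + v) = a *: (y ^+ n * u : R^o) + y ^+ n * v.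
    by rewrite mulrDr -![_ *: (_ : R^o)]/(_ * _) mulrCA.
  by case: KK => _; exact.
(* The ascending colon ideals (K : y^n) become stationary. *)
have [_ [n ->] nmax] := @ideal_max R noethR
  (fun L => exists n, L = fun r : R^o => K (y ^+ n * r)) _ (ex_intro _ 0%N erefl)
  (fun L '(ex_intro n LE) => eq_ind_r (@is_submod R R^o) (chainS n) LE).
have {}nmax r : K (y ^+ n.+1 * r) -> K (y ^+ n * r).
  apply: (nmax (fun r => K (y ^+ n.+1 * r))) => [|x Kx]; first by exists n.+1.
  by rewrite exprS -mulrA; exact: (is_submodZ y KK Kx).
(* By maximality it suffices that K + (y^n) still meets the domain in the kernel. If k + y^n r has
   value v, then y times it has value yv = 0 and so lies in K; hence y^(n+1) r is in K, then y^n r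
   by stationarity, and k + y^n r lies in K. *)
exists n; apply: (Kmax (fun x => exists2 k, K k & exists r : R^o, x = k + y ^+ n * r)).
- split.
  + split; first by exists 0; [case: KK|exists 0; rewrite mulr0 addr0].
    move=> a _ _ [k Kk [r ->]] [k' Kk' [r' ->]]; exists (a *: k + k').
      by case: KK => _; apply.
    exists (a *: r + r').
    by rewrite scalerDr mulrDr addrACA -![_ *: (_ : R^o)]/(_ * _) [y ^+ n * (_ * _)]mulrCA.
  + by move=> r /kerK Kr; exists r => //; exists 0; rewrite mulr0 addr0.
  + move=> _ v [k Kk [r ->]] Tv; apply: (Kker _ v) => //.
    apply: is_submodD => //; apply: nmax.
    have Kyk := is_submodZ y KK Kk.
    rewrite -[y ^+ n.+1 * r](addKr (y *: k : R^o)) addrC.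
    apply: is_submodB => //; apply: kerK; rewrite -(yT _ _ Tv).
    have -> : y *: k + y ^+ n.+1 * r = y *: (k + y ^+ n * r : R^o).
      by rewrite scalerDr exprS -mulrA.
    exact: linrelZ.
- by move=> x Kx; exists x => //; exists 0; rewrite mulr0 addr0.
- by exists 0; [case: KK|exists 1; rewrite mulr1 add0r].
Qed.

(** For [x] in [I], finite generation of the domain gives one [n] and one [b] in [J] such that x^n -
    b kills the range of [T]. Then (x^n - b)^m kills [e], and x^(nm) agrees with it modulo [J], so
    [e] is torsion. *)
Lemma torsion_rel_injective (I J : ideal R) :
  rel_injective (fun x : E => x \in @torsion R I J E).
Proof.
apply: baer_rel_injective; first exact: submodClosed_is_submod.
move=> T TT Tf Tt; have [e eT ey] := linrel_extend TT Tf.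
exists e => //; apply/(torsionP noethR) => x xI.
have domS : is_submod (fun r : R^o => exists v, T r v).
  split; first by exists 0; case: TT.
  by move=> a u v [w Tu] [w' Tv]; exists (a *: w + w'); case: TT => _; apply.
have [s [sT Ts]] := noetherian_fg noethR domS.
pose kills n b (r : R^o) := exists2 v, T r v & (x : R) ^+ n *: v = b *: v.
have killsS n b : is_submod (kills n b).
  split; first by exists 0; rewrite ?scaler0 //; case: TT.
  move=> a r r' [v Tv xv] [v' Tv' xv']; exists (a *: v + v').
    by case: TT => _; apply.
  by rewrite !scalerDr !scalerA ![_ * a]mulrC -!scalerA xv xv'.
have [n [b [bJ skills]]] : exists n b, b \in J /\ forall r, r \in s -> kills n b r.
  elim: s sT {Ts} => [|r s IHs] sT; first by exists 0%N, 0; rewrite rpred0.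
  have [|n [b [bJ skills]]] := IHs.
    by move=> r' r's; apply: sT; rewrite inE r's orbT.
  have [v Tv] := sT r (mem_head _ _).
  have /(torsionP noethR)/(_ x xI)[m [c [cJ xc]]] := Tt _ _ Tv.
  (* The element of [J] comes from (x^n - b)(x^m - c) = x^(n+m) - (x^n c + x^m b - bc), a product
     that kills the values on the old and the new generators. *)
  exists (n + m)%N, ((x : R) ^+ n *: c + (x : R) ^+ m *: b - b *: c); split.
    by rewrite -scaleNr !rpredD ?rpredZ.
  move=> r'; rewrite inE => /predU1P[->|/skills[w Tw xb]].
    exists v => //; rewrite exprD scalerBl scalerDl.
    by rewrite -![_ *: (_ : R^o)]/(_ * _) [_ * b]mulrC -!scalerA xc addrK.
  exists w => //; rewrite exprD scalerBl scalerDl [_ ^+ n * _]mulrC.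
  rewrite -![_ *: (_ : R^o)]/(_ * _) [b * c]mulrC [_ ^+ n * c]mulrC -!scalerA xb.
  by rewrite addrAC addrC subrr addr0.
have [|m ym] := ey ((x : R) ^+ n - b).
  move=> r v Tv; have [w Tw xw] := Ts r (ex_intro _ v Tv) _ (killsS n b) skills.
  by rewrite (functional_uniq TT Tf Tv Tw) scalerBl xw subrr.
have [c cJ cE] := expr_addr_mod ((x : R) ^+ n - b) m bJ.
by exists (n * m)%N, c; rewrite exprM -[_ ^+ n](subrK b) cE scalerDl ym add0r.
Qed.

End TorsionInjective.

(** * Coboundaries of subcomplexes of relatively injective modules *)

Section Subcomplex.
Variables (R : comPzRingType) (C : cochain_complex R) (G : forall n, C n -> Prop).
Arguments G : clear implicits.
Hypotheses (GS : forall n, is_submod (G n))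
  (Gd : forall n x, G n x -> G n.+1 (cdiff C n x)).

Definition sub_coboundary n : C n -> Prop :=
  match n with
  | 0 => fun x => x = 0
  | m.+1 => fun x => exists2 y : C m, G m y & x = cdiff C m y
  end.
Arguments sub_coboundary : clear implicits.

Definition sub_exact t := forall i, (i < t)%N -> forall x : C i,
  G i x -> cdiff C i x = 0 -> sub_coboundary i x.

Lemma sub_coboundary_submod n : is_submod (sub_coboundary n).
Proof.
case: n => [|n] /=; first by split=> // a u v -> ->; rewrite scaler0 addr0.
split; first by exists 0; rewrite ?linear0 //; case: (GS n).
move=> a _ _ [x Gx ->] [y Gy ->]; exists (a *: x + y); last by rewrite linearP.
by case: (GS n) => _; exact.
Qed.

Lemma sub_coboundary_sub n x : sub_coboundary n x -> G n x.
Proof.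
by case: n x => [|n] /= x; [move=> ->; case: (GS 0)|case=> y Gy ->; exact: Gd].
Qed.

Lemma sub_coboundary_cocycle n x : sub_coboundary n x -> cdiff C n x = 0.
Proof.
by case: n x => [|n] /= x; [move=> ->; rewrite linear0|case=> y _ ->; exact: cdiffK].
Qed.

Section Exact.
Variable t : nat.
Hypotheses (Ginj : forall n, rel_injective (G n)) (Gexact : sub_exact t).

(* B^i is a direct summand of G^i, and d maps a complement isomorphically onto
   B^{i+1}. *)
Lemma sub_coboundary_injective i : (i <= t)%N -> rel_injective (sub_coboundary i).
Proof.
elim: i => [|i IHi] it X T TT Tf TB.
  exists \0 => [x|x v /TB ->] //.
(* A retraction onto B^i, obtained by extending the identity of B^i. *)
have [rho rhoB rhoK] : exists2 rho : {linear C i -> C i},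
    (forall x, sub_coboundary i (rho x)) & forall x, sub_coboundary i x -> rho x = x.
  have [|||rho rhoB rhoK] := IHi (ltnW it) (C i)
    (fun x v => sub_coboundary i x /\ x = v).
  - have [B0 BL] := sub_coboundary_submod i.
    by split=> // a x v y w [Bx <-] [By <-]; split=> //; exact: BL.
  - by move=> v [_ <-].
  - by move=> x v [Bx <-].
  by exists rho => // x Bx; exact: rhoK.
(* The component [y - rho y] of [y] in the complement depends only on dy: by exactness a cocycle of
   G^i lies in B^i, where [rho] is the identity. *)
have [|||g gG gT] := Ginj (n := i) (X := X)
  (T := fun x v => exists2 y, G i y & T x (cdiff C i y) /\ v = y - rho y).
- split.
    exists 0; first by case: (GS i).
    by split; [rewrite linear0; case: TT|rewrite linear0 oppr0 addr0].
  move=> a x _ x' _ [y Gy [Ty ->]] [y' Gy' [Ty' ->]]; exists (a *: y + y').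
    by case: (GS i) => _; exact.
  split; first by rewrite linearP; case: TT => _; exact.
  by rewrite linearP opprD addrACA scalerBr.
- move=> _ [y Gy [/Tf dy ->]]; rewrite rhoK ?subrr //.
  exact: Gexact.
- move=> _ _ [y Gy [_ ->]]; apply: is_submodB => //.
  exact/sub_coboundary_sub/rhoB.
exists (cdiff C i \o g) => [x|x v Tv] /=; first by exists (g x).
have [y Gy vy] := TB _ _ Tv; rewrite (gT x (y - rho y)).
  by rewrite linearB /= (sub_coboundary_cocycle (rhoB y)) subr0.
by exists y; rewrite // -vy.
Qed.

(* Ext^1(R/c, B^t) = 0. *)
Lemma sub_coboundary_adjust (c : R^o -> Prop) (x : C t) : is_submod c ->
    (forall r : R^o, c r -> sub_coboundary t ((r : R) *: x)) ->
  exists2 e, sub_coboundary t e & forall r : R^o, c r -> (r : R) *: (x - e) = 0.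
Proof.
move=> cS cx.
have [|||e eB eP] := rel_injective_baer (sub_coboundary_injective (leqnn t))
  (T := fun (r : R^o) v => c r /\ v = (r : R) *: x).
- split; first by rewrite scale0r; split=> //; case: cS.
  move=> a r _ r' _ [cr ->] [cr' ->]; split; last by rewrite scalerDl scalerA.
  by case: cS => _; exact.
- by move=> v [_ ->]; rewrite scale0r.
- by move=> r _ [cr ->]; exact: cx.
by exists e => // r cr; rewrite scalerBr (eP r (r *: x)) ?subrr.
Qed.

End Exact.
End Subcomplex.

(* A preimage y of x in G^m may be changed by an element of B^m so that
   it has the same annihilator as x. *)
Lemma sub_coboundary_restrict (R : comPzRingType) (C : cochain_complex R)
    (G A : forall n, C n -> Prop) t :
    (forall n, is_submod (@G n)) ->
    (forall n x, @G n x -> @G n.+1 (cdiff C n x)) ->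
    (forall n, rel_injective (@G n)) -> sub_exact G t ->
    (forall n (y : C n) (x : C n.+1),
      A n.+1 x -> (forall r : R, r *: x = 0 -> r *: y = 0) -> A n y) ->
  forall x : C t, A t x -> sub_coboundary G x -> sub_coboundary A x.
Proof.
move=> GS Gd Ginj Gexact Aann; case: t Gexact => [|m] //= Gexact _ /[swap] -[y Gy ->] Ax.
have Hinj : rel_injective (sub_coboundary G (n := m)).
  by apply: (sub_coboundary_injective GS Gd Ginj Gexact); exact: leqnSn.
(* If r kills dy, then ry is a cocycle of G^m and so lies in B^m. Baer's condition for B^m gives one
   [e] with ry = re for all such r. *)
have [|||e eB eP] := rel_injective_baer Hinj
  (T := fun (r : R^o) v => cdiff C m ((r : R) *: y) = 0 /\ v = (r : R) *: y).
- split; first by rewrite scale0r linear0.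
  move=> a r _ r' _ [dr ->] [dr' ->]; split; last by rewrite scalerDl scalerA.
  by rewrite scalerDl linearD /= dr' addr0 -scalerA linearZ /= dr scaler0.
- by move=> v [_ ->]; rewrite scale0r.
- move=> r _ [dr ->]; apply: Gexact => //; exact: is_submodZ.
have dye : cdiff C m (y - e) = cdiff C m y.
  by rewrite linearB /= (sub_coboundary_cocycle eB) subr0.
exists (y - e) => //; apply: (Aann _ _ _ Ax) => r ry.
by rewrite scalerBr (eP r (r *: y)) ?subrr // linearZ.
Qed.

(** * Noetherian modules *)

Section NoetherianModules.
Variables (R : comPzRingType) (noethR : noetherian R).

(** Induction on the generators: the coefficients of [v] in elements of [P] modulo the span of [s]
    form an ideal [L]. Lifts to [P] of generators of [L], together with generators of the part of
    [P] in the span of [s], generate [P]. *)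
Lemma fin_gen_noetherian (V : lmodType R) : fin_gen V ->
  forall P : V -> Prop, is_submod P -> fg_submod P.
Proof.
move=> [s sV].
suff main P : is_submod P ->
    (forall v, P v -> v \in generated [set` s]%classic) -> fg_submod P.
  by move=> P PP; apply: main.
elim: s {sV} P => [|v s IHs] P PP Ps.
  exists [::]; split=> // w /Ps/generatedP w0 Q QQ _; exact: w0.
have [|w [//]|s' [s'P Ps']] := IHs (fun w => P w /\ w \in generated [set` s]%classic).
- split; first by rewrite rpred0; case: PP.
  move=> a u w [Pu su] [Pw sw]; split; first by case: PP => _; exact.
  by rewrite rpredD // rpredZ.
pose L (r : R^o) := exists2 w, w \in generated [set` s]%classic & P ((r : R) *: v + w).
have LL : is_submod L.
  split; first by exists 0; rewrite ?rpred0 // scale0r addr0; case: PP.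
  move=> a r r' [w sw Pw] [w' sw' Pw']; exists (a *: w + w').
    by rewrite rpredD // rpredZ.
  rewrite scalerDl -scalerA addrACA -scalerDr.
  by case: PP => _; exact.
have [rs [rsL Lrs]] := noetherian_fg noethR LL.
have [lft lftP] : {lft : R^o -> V & forall r, L r ->
    P (lft r) /\ lft r - (r : R) *: v \in generated [set` s]%classic}.
  apply: (@choice R^o V (fun r w => L r -> P w /\
    w - (r : R) *: v \in generated [set` s]%classic)) => r.
  have [[w sw Pw]|nL] := pselect (L r); last by exists 0.
  by exists ((r : R) *: v + w) => _; rewrite addrAC subrr add0r.
exists ([seq lft r | r <- rs] ++ s'); split=> [u|u Pu Q QQ gQ].
  by rewrite mem_cat => /orP[/mapP[r /rsL/lftP[Pr _] ->]|/s'P[]].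
have /generatedP gs := Ps u Pu.
have [r sr] : exists r : R, u - r *: v \in generated [set` s]%classic.
  apply: (gs (fun u => exists r : R, u - r *: v \in generated [set` s]%classic)).
    split; first by exists 0; rewrite scale0r subr0 rpred0.
    move=> a x y [r xr] [r' yr']; exists (a * r + r').
    by rewrite scalerDl opprD addrACA -scalerA -scalerBr rpredD // rpredZ.
  move=> w; rewrite inE => /predU1P[->|ws].
    by exists 1; rewrite scale1r subrr rpred0.
  by exists 0; rewrite scale0r subr0; apply/generatedP => P' _; exact.
(* An element of [P] and [Q] with the same [v]-coefficient as [u]; the difference [u - w] falls
   under the induction hypothesis. *)
have [w [Pw Qw sw]] : exists w, [/\ P w, Q w &
    w - r *: v \in generated [set` s]%classic].
  apply: (Lrs r _ (fun r : R^o => exists w, [/\ P w, Q w &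
    w - (r : R) *: v \in generated [set` s]%classic])).
  - by exists (u - r *: v); rewrite // addrC subrK.
  - split; first by exists 0; rewrite scale0r subr0 rpred0; case: PP; case: QQ.
    move=> a x y [w [Pw Qw xw]] [w' [Pw' Qw' yw']]; exists (a *: w + w'); split.
    + by case: PP => _; exact.
    + by case: QQ => _; exact.
    + by rewrite scalerDl opprD addrACA -scalerA -scalerBr rpredD // rpredZ.
  - move=> r' r's; have [Pl sl] := lftP _ (rsL _ r's); exists (lft r'); split=> //.
    by apply: gQ; rewrite mem_cat map_f.
rewrite -[u](subrK w); apply: is_submodD => //; apply: Ps' => //.
  split; first exact: is_submodB.
  have -> : u - w = u - r *: v + (- 1) *: (w - r *: v).
    by rewrite scaleN1r opprB addrA subrK.
  by rewrite rpredD // rpredZ.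
by move=> x xs'; apply: gQ; rewrite mem_cat xs' orbT.
Qed.

Definition single k (V : lmodType R) (i : 'I_k) (v : V) : {ffun 'I_k -> V} :=
  [ffun j => if j == i then v else 0].

Lemma single_linear k (V : lmodType R) (i : 'I_k) : linear (@single k V i).
Proof.
by move=> a u v; apply/ffunP => j; rewrite !ffunE; case: eqP => // _; rewrite scaler0 addr0.
Qed.

Lemma single_sum k (V : lmodType R) (f : {ffun 'I_k -> V}) :
  f = \sum_i single i (f i).
Proof.
apply/ffunP => j; rewrite sum_ffunE (bigD1 j) //= !ffunE eqxx big1 ?addr0 //.
by move=> i ij; rewrite !ffunE eq_sym (negbTE ij).
Qed.

Lemma fin_gen_ffun k (V : lmodType R) : fin_gen V -> fin_gen {ffun 'I_k -> V}.
Proof.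
move=> [s sV]; exists [seq single i v | i <- enum 'I_k, v <- s] => f.
apply/generatedP => P PP sP; rewrite [f]single_sum.
apply: is_submod_sum => // i; have /generatedP gf := sV (f i).
apply: (gf (fun v => P (single i v))).
  split=> [|a u v Pu Pv]; last by rewrite single_linear; case: PP => _; exact.
  rewrite (_ : single i 0 = 0); first by case: PP.
  by apply/ffunP => j; rewrite !ffunE if_same.
by move=> v vs; apply: sP; apply/allpairsP; exists (i, v); rewrite mem_enum.
Qed.

Lemma fin_gen_regular : fin_gen R^o.
Proof.
exists [:: 1] => r; apply/generatedP => P PP sP.
rewrite -[r](mulr1 (r : R)); apply: (is_submodZ (r : R) PP).
by apply: sP; rewrite inE.
Qed.

End NoetherianModules.

(** * Finite generation of Ext *)

Section Dot.
Variable R : comPzRingType.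

(** A tuple [e] is a linear map from R^k to [V], and [dot q e] is its value at [q]. *)
Definition dot k (V : lmodType R) (q : {ffun 'I_k -> R^o}) (e : {ffun 'I_k -> V}) : V :=
  \sum_i (q i : R) *: e i.

Lemma dotPl k (V : lmodType R) a (p q : {ffun 'I_k -> R^o}) (e : {ffun 'I_k -> V}) :
  dot (a *: p + q) e = a *: dot p e + dot q e.
Proof.
rewrite /dot scaler_sumr -big_split; apply: eq_bigr => i _.
by rewrite !ffunE scalerDl scalerA.
Qed.

Lemma dotPr k (V : lmodType R) a (q : {ffun 'I_k -> R^o}) (e f : {ffun 'I_k -> V}) :
  dot q (a *: e + f) = a *: dot q e + dot q f.
Proof.
rewrite /dot scaler_sumr -big_split; apply: eq_bigr => i _.
by rewrite !ffunE scalerDr !scalerA mulrC.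
Qed.

Lemma dot0r k (V : lmodType R) (q : {ffun 'I_k -> R^o}) : dot q (0 : {ffun 'I_k -> V}) = 0.
Proof. by rewrite /dot big1 // => i _; rewrite ffunE scaler0. Qed.

Lemma dotBr k (V : lmodType R) (q : {ffun 'I_k -> R^o}) (e f : {ffun 'I_k -> V}) :
  dot q (e - f) = dot q e - dot q f.
Proof. by rewrite /dot -sumrB; apply: eq_bigr => i _; rewrite !ffunE scalerBr. Qed.

Lemma dot_map k (V W : lmodType R) (f : {linear V -> W}) (q : {ffun 'I_k -> R^o})
    (e : {ffun 'I_k -> V}) :
  dot q [ffun i => f (e i)] = f (dot q e).
Proof.
by rewrite /dot linear_sum; apply: eq_bigr => i _; rewrite ffunE linearZ.
Qed.

Lemma dot_comp k l (V : lmodType R) (q : {ffun 'I_l -> R^o})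
    (P : 'I_l -> {ffun 'I_k -> R^o}) (e : {ffun 'I_k -> V}) :
  dot (\sum_i (q i : R) *: P i) e = dot q [ffun i => dot (P i) e].
Proof.
rewrite /dot; under [RHS]eq_bigr => i _ do rewrite ffunE scaler_sumr.
rewrite exchange_big; apply: eq_bigr => j _.
rewrite sum_ffunE scaler_suml; apply: eq_bigr => i _.
by rewrite ffunE -scalerA.
Qed.

(** The condition on syzygies makes the assignment of [theta i] to [P i] a well-defined map on the
    span of the [P i]. It extends to R^k by injectivity, and [psi] lists the values on the standard
    basis. *)
Lemma injective_solve (E : lmodType R) k l (P : 'I_l -> {ffun 'I_k -> R^o})
    (theta : {ffun 'I_l -> E}) : injective_module E ->
    (forall q : {ffun 'I_l -> R^o}, \sum_i (q i : R) *: P i = 0 -> dot q theta = 0) ->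
  exists psi, forall i, dot (P i) psi = theta i.
Proof.
move=> injE theta0.
have [|||g _ gP] := injective_rel_injective injE (X := {ffun 'I_k -> R^o})
    (T := fun u v => exists q : {ffun 'I_l -> R^o},
      u = \sum_i (q i : R) *: P i /\ v = dot q theta) => //.
- split.
    exists 0; split; last by rewrite /dot big1 // => i _; rewrite ffunE scale0r.
    by rewrite big1 // => i _; rewrite ffunE scale0r.
  move=> a _ _ _ _ [q [-> ->]] [q' [-> ->]]; exists (a *: q + q').
  rewrite dotPl scaler_sumr -big_split; split=> //; apply: eq_bigr => i _.
  by rewrite !ffunE scalerDl scalerA.
- by move=> v [q [/esym/theta0 + ->]].
pose e := [ffun j : 'I_k => single j (1 : R^o)].
exists [ffun j => g (e j)] => i; rewrite dot_map.
apply: gP; exists (single i (1 : R^o)); split.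
  rewrite (bigD1 i) //= ffunE eqxx scale1r big1 ?addr0; last first.
    by move=> j ji; rewrite ffunE (negbTE ji) scale0r.
  rewrite [RHS]single_sum; apply: eq_bigr => j _; apply/ffunP => m.
  by rewrite !ffunE; case: eqP => _; rewrite ?scaler0 // -[RHS]mulr1.
rewrite /dot (bigD1 i) //= ffunE eqxx scale1r big1 ?addr0 // => j ji.
by rewrite ffunE (negbTE ji) scale0r.
Qed.

Definition perp k (V : lmodType R) (K : {ffun 'I_k -> R^o} -> Prop)
  (e : {ffun 'I_k -> V}) := forall q, K q -> dot q e = 0.

Lemma perp_submod k (V : lmodType R) (K : {ffun 'I_k -> R^o} -> Prop) :
  is_submod (@perp k V K).
Proof.
split=> [q _|a e f Ke Kf q Kq]; first exact: dot0r.
by rewrite dotPr Ke // Kf // scaler0 addr0.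
Qed.

End Dot.

Section ExtFinite.
Variables (R : comPzRingType) (noethR : noetherian R) (M : lmodType R).
Hypothesis fgM : fin_gen M.
Variable E : injective_resolution M.

(** The coboundaries of the complex Hom(R^k / K, E). *)
Definition perp_coboundary n k (K : {ffun 'I_k -> R^o} -> Prop) :
    {ffun 'I_k -> E n} -> Prop :=
  match n with
  | 0 => fun e => e = 0
  | m.+1 => fun e => exists2 w : {ffun 'I_k -> E m},
      perp K w & e = [ffun i => cdiff E m (w i)]
  end.

(* {e in (E^n)^k | K e = 0} is Hom(R^k / K, E^n): this says that
   Ext^n(R^k / K, M) is finitely generated. Dimension shifting uses the
   submodule K, presented by generators P and syzygies L, in place of R^k / K. *)
Lemma ext_fin_gen n k (K : {ffun 'I_k -> R^o} -> Prop) : is_submod K ->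
  exists s : seq {ffun 'I_k -> E n},
    (forall e, e \in s -> perp K e /\ forall i, cdiff E n (e i) = 0) /\
    forall e, perp K e -> (forall i, cdiff E n (e i) = 0) ->
      forall Q, is_submod Q -> (forall f, f \in s -> Q f) ->
        (forall f, perp_coboundary K f -> Q f) -> Q e.
Proof.
elim: n k K => [|n IHn] k K KS.
  (* By left exactness of Hom, the cocycles of degree 0 form Hom(R^k / K, M), a submodule of the
     Noetherian module M^k. *)
  have Zfg : fg_submod (fun m : {ffun 'I_k -> M} => perp K m).
    exact/(fin_gen_noetherian noethR (fin_gen_ffun k fgM))/perp_submod.
  have [s [sZ Zs]] := Zfg.
  pose aug (m : {ffun 'I_k -> M}) := [ffun i => ires_aug E (m i)].
  exists [seq aug m | m <- s]; split.
    move=> _ /mapP[m /sZ Km ->]; split=> [q Kq|i]; first by rewrite dot_map Km ?linear0.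
    by rewrite ffunE; apply/ires_exact0; exists (m i).
  move=> e Ke de Q QS sQ _.
  have [m mP] : {m : 'I_k -> M & forall i, e i = ires_aug E (m i)}.
    by apply: (@choice _ _ (fun i m => e i = ires_aug E m)) => i; exact/ires_exact0.
  have eE : e = aug (finfun m) by apply/ffunP => i; rewrite !ffunE.
  rewrite eE; apply: (Zs _ _ (fun m => Q (aug m))).
  - move=> q Kq; apply: (@ires_aug_inj _ _ E); rewrite linear0 -dot_map.
    by rewrite -[X in dot q X]eE Ke.
  - split.
      have -> : aug 0 = 0 by apply/ffunP => i; rewrite !ffunE linear0.
      by case: QS.
    move=> a u v Qu Qv; have -> : aug (a *: u + v) = a *: aug u + aug v.
      by apply/ffunP => i; rewrite !ffunE linearP.
    by case: QS => _; exact.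
  - by move=> w ws; apply: sQ; exact: map_f.
have [ps [psK Kps]] :=
  fin_gen_noetherian noethR (fin_gen_ffun k (fin_gen_regular R)) KS.
pose P (i : 'I_(size ps)) := nth 0 ps i.
have PK i : K (P i) by apply/psK/mem_nth.
have perpP (V : lmodType R) (e : {ffun 'I_k -> V}) :
    (forall i, dot (P i) e = 0) -> perp K e.
  move=> Pe q Kq; apply: (Kps q Kq (fun q => dot q e = 0)).
    split=> [|a u v ue ve]; last by rewrite dotPl ue ve scaler0 addr0.
    by rewrite /dot big1 // => i _; rewrite ffunE scale0r.
  by move=> w /(nthP 0)[i il <-]; exact: (Pe (Ordinal il)).
(* [L] is the syzygy module of the [P i], so K is R^l / L with l the number of generators, and
   [perp L] describes Hom(K, V). *)
pose L (q : {ffun 'I_(size ps) -> R^o}) := \sum_i (q i : R) *: P i = 0.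
have LS : is_submod L.
  rewrite /L; split=> [|a u v uL vL]; first by rewrite big1 // => i _; rewrite ffunE scale0r.
  transitivity (a *: (\sum_i (u i : R) *: P i) + \sum_i (v i : R) *: P i).
    rewrite scaler_sumr -big_split; apply: eq_bigr => i _.
    by rewrite !ffunE scalerDl scalerA.
  by rewrite uL vL scaler0 addr0.
pose dv m (e : {ffun 'I_k -> E m}) := [ffun i => cdiff E m (e i)].
have dvP m a u v : dv m (a *: u + v) = a *: dv m u + dv m v.
  by apply/ffunP => i; rewrite !ffunE linearP.
have dv0 m : dv m 0 = 0 by apply/ffunP => i; rewrite !ffunE linear0.
(* A coboundary of Hom(K, E) extends to a coboundary on R^k, which the differential kills; it
   therefore contributes nothing in the next degree. *)
have coblift theta : @perp_coboundary n (size ps) L theta ->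
    exists psi, (forall i, dot (P i) psi = theta i) /\ dv n psi = 0.
  case: n {IHn} theta => [|m] theta /=.
    by move=> ->; exists 0; split=> [i|]; rewrite ?dot0r ?ffunE ?dv0.
  move=> [chi Lchi ->]; have [w wP] := injective_solve (@ires_inj _ _ E m) Lchi.
  exists (dv m w); split=> [i|]; first by rewrite dot_map wP ffunE.
  by apply/ffunP => i; rewrite !ffunE cdiffK.
have [s [sZ Zs]] := IHn _ L LS.
have [lft lftP] : {lft : {ffun 'I_(size ps) -> E n} -> {ffun 'I_k -> E n} &
    forall theta, perp L theta -> forall i, dot (P i) (lft theta) = theta i}.
  apply: (@choice _ _ (fun theta psi => perp L theta ->
    forall i, dot (P i) psi = theta i)) => theta.
  have [Ltheta|nL] := pselect (perp L theta); last by exists 0.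
  by have [psi psiP] := injective_solve (@ires_inj _ _ E n) Ltheta; exists psi.
exists [seq dv n (lft theta) | theta <- s]; split.
  move=> _ /mapP[theta /sZ[Lt dt] ->]; split=> [|i]; last by rewrite ffunE cdiffK.
  by apply: perpP => i; rewrite dot_map lftP.
move=> e Ke de Q QS sQ cQ.
have [psi psiP] : {psi : 'I_k -> E n & forall i, e i = cdiff E n (psi i)}.
  by apply: (@choice _ _ (fun i y => e i = cdiff E n y)) => i; exact/ires_exactS.
have eE : e = dv n (finfun psi) by apply/ffunP => i; rewrite !ffunE.
(* The restriction of [psi] to K is a cocycle of Hom(K, E), because its differential is the
   restriction of [e]. The induction hypothesis yields [psi'] with the same restriction and with
   differential in [Q]. *)
have [psi' [Ppsi' Qpsi']] : exists psi', (forall i, dot (P i) psi' =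
    [ffun i => dot (P i) (finfun psi)] i) /\ Q (dv n psi').
  apply: (Zs _ _ _ (fun theta => exists psi', (forall i, dot (P i) psi' =
    theta i) /\ Q (dv n psi'))).
  - move=> q Lq; rewrite -dot_comp Lq /dot big1 // => i _.
    by rewrite ffunE scale0r.
  - by move=> i; rewrite ffunE -dot_map -[X in dot _ X]eE Ke.
  - split.
      exists 0; split=> [i|]; first by rewrite dot0r ffunE.
      by rewrite dv0; case: QS.
    move=> a u v [x [Px Qx]] [y [Py Qy]]; exists (a *: x + y); split=> [i|].
      by rewrite dotPr Px Py !ffunE.
    by rewrite dvP; case: QS => _; exact.
  - move=> theta st; exists (lft theta); split.
      by case: (sZ _ st) => /lftP.
    by apply: sQ; exact: map_f.
  - move=> theta /coblift[chi [Pchi dchi]]; exists chi; split=> //.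
    by rewrite dchi; case: QS.
(* The difference of [psi] and [psi'] vanishes on K, so its differential is a coboundary of Hom(R^k
   / K, E). *)
have -> : e = 1 *: dv n psi' + dv n (finfun psi - psi').
  by apply/ffunP => i; rewrite scale1r eE !ffunE linearB addrC subrK.
case: (QS) => _; apply=> //; apply: cQ; exists (finfun psi - psi') => //.
by apply: perpP => i; rewrite dotBr Ppsi' ffunE subrr.
Qed.

(* The case k = 1: {x in E^n | c x = 0} is Hom(R/c, E^n). *)
Lemma ext_fin_gen_ideal n (c : R^o -> Prop) : is_submod c ->
    let killed m (x : E m) := forall r : R^o, c r -> (r : R) *: x = 0 in
  exists s : seq (E n),
    (forall x, x \in s -> killed n x /\ cdiff E n x = 0) /\
    forall x, killed n x -> cdiff E n x = 0 ->
      forall Q, is_submod Q -> (forall y, y \in s -> Q y) ->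
        (forall y, sub_coboundary killed y -> Q y) -> Q x.
Proof.
move=> [c0 cL] killed; pose K (q : {ffun 'I_1 -> R^o}) := c (q ord0).
have KS : is_submod K by split; rewrite /K => *; rewrite !ffunE //; exact: cL.
have dot1 m (q : {ffun 'I_1 -> R^o}) (e : {ffun 'I_1 -> E m}) :
  dot q e = (q ord0 : R) *: e ord0 by rewrite /dot big_ord1.
have perp1 m (e : {ffun 'I_1 -> E m}) : perp K e -> killed m (e ord0).
  by move=> Ke r cr; have := Ke [ffun=> r]; rewrite dot1 /K !ffunE; exact.
have [s [sZ Zs]] := ext_fin_gen n KS.
exists [seq f ord0 | f : {ffun 'I_1 -> E n} <- s]; split.
  by move=> _ /mapP[f /sZ[/perp1 kf df] ->].
move=> x kx dx Q QS sQ cQ; rewrite -[x](@ffunE 'I_1 _ (fun=> x) ord0).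
apply: (Zs _ _ _ (fun f => Q (f ord0))).
- by move=> q Kq; rewrite dot1 ffunE; exact: kx.
- by move=> i; rewrite ffunE.
- by case: QS => Q0 QL; split=> [|a u v Qu Qv]; rewrite !ffunE //; exact: QL.
- by move=> f fs; apply: sQ; exact: map_f.
- move=> f fB; apply: cQ; case: (n) f fB => [|m] f /=.
    by move=> ->; rewrite ffunE.
  by move=> [w /perp1 kw ->]; exists (w ord0); rewrite ?ffunE.
Qed.

End ExtFinite.

(** * Local cohomology as a subquotient *)

(* Z, u and class play the roles of the cocycles, their inclusion in the ambient
   complex and the projection to cohomology. *)
Section Subquotient.
Variables (R : comPzRingType) (Z V H : lmodType R).
Variables (u : {linear Z -> V}) (class : {linear Z -> H}) (B : V -> Prop).
Hypotheses (class_surj : forall q, exists z, class z = q)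
  (class_eq0 : forall z, class z = 0 <-> B (u z)).

Lemma subquotient_annihilator (r : R^o) :
  r \in annihilator H <-> forall z, B ((r : R) *: u z).
Proof.
split=> [/asboolP rH z|rB].
  by rewrite -linearZ; apply/class_eq0; rewrite linearZ; exact: rH.
apply/asboolP => q; have [z <-] := class_surj q.
by rewrite -linearZ; apply/class_eq0; rewrite linearZ; exact: rB.
Qed.

(** Elements of [B] have class zero, so if [s] and [B] together span the image of [u], the classes
    of [s] alone generate [H]. *)
Lemma subquotient_fin_gen (s : seq V) :
    (forall x, x \in s \/ B x -> exists z, u z = x) ->
    (forall z Q, is_submod Q -> (forall x, x \in s \/ B x -> Q x) -> Q (u z)) ->
  fin_gen H.
Proof.
move=> su sB.
have [cls clsP] : {cls : V -> H & forall x, x \in s ->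
    exists2 z, u z = x & class z = cls x}.
  apply: (@choice _ _ (fun x q => x \in s ->
    exists2 z, u z = x & class z = q)) => x.
  have [xs|_] := boolP (x \in s); last by exists 0.
  by have [z zx] := su x (or_introl xs); exists (class z) => _; exists z.
exists [seq cls x | x <- s] => q; apply/generatedP => N NS sN.
have [z <-] := class_surj q.
have [w wz Nw] : exists2 w, u w = u z & N (class w).
  apply: (sB z (fun x => exists2 w, u w = x & N (class w))).
    split; first by exists 0; rewrite linear0 //; case: NS.
    move=> a _ _ [y <- Ny] [y' <- Ny']; exists (a *: y + y'); rewrite linearP //.
    by case: NS => _; exact.
  move=> x [xs|Bx].
    have [w wx wcls] := clsP x xs; exists w => //.
    by rewrite wcls; apply: sN; exact: map_f.
  have [w wx] := su x (or_intror Bx); exists w => //.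
  by rewrite (class_eq0 w).2 ?wx //; case: NS.
suff -> : class z = class w by [].
apply/eqP; rewrite -subr_eq0 -linearB; apply/eqP/class_eq0.
by rewrite linearB wz subrr -[0](linear0 u); apply/class_eq0; rewrite linear0.
Qed.

End Subquotient.

(** * The torsion complex seen inside the injective resolution *)

Section LocalCohomology.
Variables (R : comPzRingType) (I J : ideal R) (M : lmodType R).

Let E := resolution M.
Let D := fmap_complex (Gamma I J) E.

Definition torsion_family n (x : E n) : Prop := x \in @torsion R I J (E n).
Arguments torsion_family : clear implicits.

Lemma torsion_family_submod n : is_submod (torsion_family n).
Proof. exact: submodClosed_is_submod. Qed.

Lemma torsion_family_diff n x :
  torsion_family n x -> torsion_family n.+1 (cdiff E n x).
Proof. move=> tx; exact: (torsion_map_subproof (cdiff E n) (Sub x tx)). Qed.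

Definition torsion_val n : {linear D n -> E n} :=
  (val : {linear submodule (@torsion R I J (E n)) -> E n}).

Lemma torsion_val_inj n : injective (torsion_val n).
Proof. exact: val_inj. Qed.

Lemma torsion_valP n (y : D n) : torsion_family n (torsion_val n y).
Proof. exact: (valP (y : submodule (@torsion R I J (E n)))). Qed.

Lemma torsion_val_surj n x : torsion_family n x -> exists y, torsion_val n y = x.
Proof. by move=> tx; exists (Sub x tx : submodule (@torsion R I J (E n))). Qed.

Lemma torsion_val_diff n (y : D n) :
  torsion_val n.+1 (cdiff D n y) = cdiff E n (torsion_val n y).
Proof. by []. Qed.

Lemma is_coboundary_torsion n (y : D n) :
  @is_coboundary R D n y <-> sub_coboundary torsion_family (torsion_val n y).
Proof.
case: n y => [|n] y.
  split=> [->|y0]; first exact: linear0.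
  by apply: torsion_val_inj; rewrite [LHS]y0 [RHS]linear0.
split=> [[x ->]|[x /torsion_val_surj[x' <-]]].
  exists (torsion_val n x); first exact: torsion_valP.
  exact: torsion_val_diff.
by rewrite -torsion_val_diff => /torsion_val_inj ->; exists x'.
Qed.

Definition underlying n : {linear submodule (@cocycle R D n) -> E n} :=
  torsion_val n \o (val : {linear submodule (@cocycle R D n) -> D n}).

Definition class n : {linear submodule (@cocycle R D n) -> local_cohomology I J n M} :=
  @to_quotient R _ (@coboundary R D n).

Lemma underlying_torsion n z : torsion_family n (underlying n z).
Proof. exact: torsion_valP. Qed.

Lemma underlying_cocycle n z : cdiff E n (underlying n z) = 0.
Proof.
have /eqP dz := valP z.
by rewrite -[LHS](torsion_val_diff (val z)) dz linear0.
Qed.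

Lemma underlying_surj n x : torsion_family n x -> cdiff E n x = 0 ->
  exists z, underlying n z = x.
Proof.
move=> /torsion_val_surj[y <-]; rewrite -torsion_val_diff => dy.
have yP : y \in @cocycle R D n.
  by apply/eqP/torsion_val_inj; rewrite dy linear0.
by exists (Sub y yP).
Qed.

Lemma class_surj n q : exists z, class n z = q.
Proof. exact: to_quotientP. Qed.

Lemma class_eq0 n z :
  class n z = 0 <-> sub_coboundary torsion_family (underlying n z).
Proof.
rewrite -is_coboundary_torsion -[X in _ = X](linear0 (class n)).
by rewrite to_quotient_eq subr0; split=> /asboolP.
Qed.

Lemma local_cohomology_exact t :
    (forall i, (i < t)%N -> forall q : local_cohomology I J i M, q = 0) ->
  sub_exact torsion_family t.
Proof.
move=> H0 i it x tx dx.
by have [z <-] := underlying_surj tx dx; apply/class_eq0/H0.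
Qed.

Lemma annihilatorP t (r : R^o) : r \in annihilator (local_cohomology I J t M) <->
  forall x, torsion_family t x -> cdiff E t x = 0 ->
    sub_coboundary torsion_family ((r : R) *: x).
Proof.
apply: (iff_trans (subquotient_annihilator (@class_surj t) (@class_eq0 t) r)).
split=> [rB x tx dx|rB z]; first by have [z <-] := underlying_surj tx dx.
by apply: rB; [exact: underlying_torsion|exact: underlying_cocycle].
Qed.

End LocalCohomology.

(** * Comparison of the two cohomologies, and finite generation *)

Section Main.
Variables (R : comPzRingType) (noethR : noetherian R) (M : lmodType R).

Let E := resolution M.

Lemma torsion_family_injective (I J : ideal R) n :
  rel_injective (@torsion_family R I J M n).
Proof. exact/torsion_rel_injective/ires_inj. Qed.

(* H^t_a(M) embeds into H^t_{I,J}(M) once the lower H^i_{I,J}(M) vanish. *)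
Lemma coboundary_W_tilde (I J a : ideal R) t : W_tilde I J a ->
    sub_exact (@torsion_family R I J M) t ->
  forall x : E t, torsion_family a zero_ideal x ->
    sub_coboundary (@torsion_family R I J M) x ->
    sub_coboundary (@torsion_family R a zero_ideal M) x.
Proof.
move=> aW Gexact; apply: sub_coboundary_restrict Gexact _.
- exact: torsion_family_submod.
- exact: torsion_family_diff.
- exact: torsion_family_injective.
- move=> n y x /(torsion0P noethR) xa yx; apply/(torsion0P noethR) => r /xa[m mx].
  by exists m; exact: yx.
Qed.

Lemma local_cohomology_fin_gen (a : ideal R) t : fin_gen M ->
    sub_exact (@torsion_family R a zero_ideal M) t ->
    {subset a <= radical (annihilator (local_cohomology a zero_ideal t M))} ->
  fin_gen (local_cohomology a zero_ideal t M).
Proof.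
move=> fgM Aexact a_sub; pose A := @torsion_family R a zero_ideal M.
have AS n : is_submod (A n) by exact: torsion_family_submod.
have Ad n x : A n x -> A n.+1 (cdiff E n x) by exact: torsion_family_diff.
(* For [c] the annihilator of the cohomology: elements killed by [c] are [a]-torsion since [a] lies
   in its radical, and [c] multiplies cocycles of [A] into coboundaries. *)
have [c [cS cA cB]] : exists c : R^o -> Prop, [/\ is_submod c,
    forall n (y : E n), (forall r : R^o, c r -> (r : R) *: y = 0) -> A n y &
    forall (x : E t) (r : R^o), A t x -> cdiff E t x = 0 -> c r ->
      sub_coboundary A ((r : R) *: x)].
  exists (fun r => r \in annihilator (local_cohomology a zero_ideal t M)); split.
  - exact: submodClosed_is_submod.
  - move=> n y cy; apply/(torsion0P noethR) => r /a_sub/asboolP[m _ rm].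
    by exists m; exact: cy.
  - by move=> x r tx dx /annihilatorP; exact.
have [s [sZ Zs]] := ext_fin_gen_ideal noethR fgM E t cS.
apply: (subquotient_fin_gen (@class_surj R a zero_ideal M t)
  (@class_eq0 R a zero_ideal M t) (s := s)) => [x [/sZ[/cA Ax dx]|Bx]|z Q QS sQ].
- exact: underlying_surj.
- apply: underlying_surj; first exact: (sub_coboundary_sub AS Ad).
  exact: sub_coboundary_cocycle Bx.
have := underlying_torsion z; have := underlying_cocycle z.
move: (underlying _ _ _ _ z) => x dx Ax.
(* Subtracting the coboundary [e] gives a representative killed by [c], to which the finiteness of
   Ext applies. *)
have [e eB ex] := sub_coboundary_adjust AS Ad (@torsion_family_injective a zero_ideal)
  Aexact cS (fun r => cB x r Ax dx).
rewrite -[x](subrK e); apply: is_submodD => //; last by apply: sQ; right.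
apply: Zs => //.
- rewrite linearB; apply/eqP; rewrite subr_eq0; apply/eqP.
  exact: etrans dx (esym (sub_coboundary_cocycle eB)).
- by move=> y ys; apply: sQ; left.
(* A coboundary of the subcomplex killed by [c] is one of the larger complex [A]. *)
move=> y yB; apply: sQ; right.
case: (t) y yB => [|n] y //= [w /cA Aw ->].
by exists w.
Qed.

End Main.

Theorem corollary3p7 (R : comPzRingType) (noethR : noetherian R)
    (I J : ideal R) (t : nat) (M : lmodType R) (fgM : fin_gen M)
    (a : ideal R) (aW : W_tilde I J a)
    (vanish : forall i : nat, (i < t)%N ->
       forall x : local_cohomology I J i M, x = 0)
    (a_sub : {subset a <= radical (annihilator (local_cohomology I J t M))}) :
  {subset a <= radical (annihilator (local_cohomology a zero_ideal t M))} /\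
  fin_gen (local_cohomology a zero_ideal t M).
Proof.
have Gexact := local_cohomology_exact vanish.
have tors (n : nat) (x : resolution M n) :
    torsion_family a zero_ideal x -> torsion_family I J x.
  exact: torsion_W_tilde.
(* The same power of [r] works: it turns an [a]-torsion cocycle into an (I,J)-coboundary that is
   still [a]-torsion, hence into an [a]-torsion coboundary. *)
have a_rad : {subset a <= radical (annihilator (local_cohomology a zero_ideal t M))}.
  move=> r /a_sub/asboolP[n n0 /annihilatorP rn]; apply/asboolP; exists n => //.
  apply/annihilatorP => x tx dx; apply: (coboundary_W_tilde noethR aW Gexact).
    exact: (is_submodZ _ (@torsion_family_submod R a zero_ideal M t) tx).
  by apply: rn => //; exact: tors.
(* The [a]-torsion complex is exact below [t]: for i < t the comparison of coboundaries applies in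
   degree [i], with exactness of the (I,J)-torsion complex below [i]. *)
split=> //; apply: local_cohomology_fin_gen => // i it x tx dx.
apply: (coboundary_W_tilde noethR aW) => //; last by apply: Gexact => //; exact: tors.
by move=> j ji; apply: Gexact; exact: ltn_trans ji it.
Qed.
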